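(* Let $1\leqslant k<n$. For a $k$-dimensional free boundary minimal geodesic ball $\mathbb B^k(r)\subset\mathbb B^n(r)$, where $\mathbb B^n(r)\subset\mathbb S^n_+$ ($0<r<\frac{\pi}{2}$) or $\mathbb B^n(r)\subset\mathbb H^n$ ($r>0$), one has $\mathrm{Ind}_S(\mathbb B^k(r))=1$.
   Context: $\mathbb S^n_+$ is the upper hemisphere $\{x_0>0\}$ of the unit sphere in Euclidean $\mathbb R^{n+1}$; $\mathbb H^n$ is the upper sheet of $-x_0^2+\sum_{i=1}^nx_i^2=-1$ in $\mathbb R^{n+1}$ with the metric $-dx_0^2+\sum_{i=1}^ndx_i^2$. $\mathbb B^n(r)$ is the geodesic ball of radius $r$ centred at $(1,0,\ldots,0)$. $\mathbb B^k(r)$ is the totally geodesic submanifold $\mathbb B^n(r)\cap\Pi$, where $\Pi\subset\mathbb R^{n+1}$ is a linear subspace of dimension $k+1$ containing $(1,0,\ldots,0)$; $g$ denotes its induced metric. With $\Delta_g=-\mathrm{div}_g\nabla^g$ and $\eta$ the outward conormal, the $\alpha$-Steklov eigenvalues of $(\Sigma,g)$ are the numbers $\sigma$ (with multiplicity) for which $\Delta_gu=\alpha u$ in $\Sigma$, $\frac{\partial u}{\partial\eta}=\sigma u$ on $\partial\Sigma$ has a nonzero solution. For a $k$-dimensional free boundary minimal submanifold $\Sigma$ of $\mathbb B^n(r)$, the spectral index $\mathrm{Ind}_S(\Sigma)$ is the number (with multiplicities) of $k$-Steklov eigenvalues less than $\cot r$ if $\Sigma\subset\mathbb S^n_+$,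 and of $(-k)$-Steklov eigenvalues less than $\coth r$ if $\Sigma\subset\mathbb H^n$. *)

(* Defs.v *)
From HB Require Import structures.
From mathcomp Require Import all_boot all_order all_algebra.
From mathcomp Require Import all_classical all_reals all_analysis.
Set Implicit Arguments.
Unset Strict Implicit.
Unset Printing Implicit Defensive.
Import Order.TTheory GRing.Theory Num.Theory.
Import numFieldNormedType.Exports.
Local Open Scope classical_set_scope.
Local Open Scope ring_scope.

Section Calculus.
Variables (R : realType) (d : nat).

Definition partial (V : normedModType R) (i : 'I_d) (f : 'rV[R]_d -> V) :
  'rV[R]_d -> V := fun y => 'D_(delta_mx 0 i) f y.

(* C^oo on an open set: all iterated partial derivatives are differentiable. *)
Definition smooth_on (U : set 'rV[R]_d) (f : 'rV[R]_d -> R) : Prop :=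
  forall (s : seq 'I_d) (y : 'rV[R]_d), U y -> differentiable (foldr (@partial R) f s) y.

(* A function on an arbitrary subset of R^d is smooth when it is the
   restriction of a smooth function on an open neighbourhood. *)
Definition smooth_near (A : set 'rV[R]_d) (f : 'rV[R]_d -> R) : Prop :=
  exists U : set 'rV[R]_d, [/\ open U, A `<=` U & smooth_on U f].

End Calculus.

(* Riemannian operators in a coordinate chart of dimension k, for a metric
   given by its Gram matrix g = (g_ij); vector fields are rows (X^1 .. X^k). *)
Section Riemannian.
Variables (R : realType) (k : nat) (g : 'rV[R]_k -> 'M[R]_k).

Definition metric (y v w : 'rV[R]_k) : R := (v *m g y *m w^T) 0 0.

(* (grad f)^i = \sum_j g^{ij} d_j f *)
Definition grad (f : 'rV[R]_k -> R) : 'rV[R]_k -> 'rV[R]_k :=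
  fun y => (\row_j partial j f y) *m invmx (g y).

(* div X = |g|^{-1/2} \sum_i d_i (|g|^{1/2} X^i) *)
Definition divergence (X : 'rV[R]_k -> 'rV[R]_k) : 'rV[R]_k -> R :=
  fun y => (Num.sqrt (\det (g y)))^-1 *
    \sum_(i < k) partial i (fun z => (Num.sqrt (\det (g z)) * X z 0 i : R)) y.

Definition laplacian (f : 'rV[R]_k -> R) : 'rV[R]_k -> R :=
  fun y => - divergence (grad f) y.

(* Outward unit conormal along the level sets of rho, for the sublevel domain
   {rho <= r}: the gradient of rho, normalized. *)
Definition conormal (rho : 'rV[R]_k -> R) : 'rV[R]_k -> 'rV[R]_k :=
  fun y => (Num.sqrt (metric y (grad rho y) (grad rho y)))^-1 *: grad rho y.

End Riemannian.

Inductive geometry := Spherical | Hyperbolic.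

Section SpaceForm.
Variables (R : realType) (n : nat) (M : geometry).

Definition curvature : R := match M with Spherical => 1 | Hyperbolic => -1 end.

(* The Euclidean (resp. Lorentzian) scalar product
   +/- x_0 y_0 + \sum_(1 <= i <= n) x_i y_i. *)
Definition form (x y : 'rV[R]_n.+1) : R :=
  curvature * (x 0 0 * y 0 0) +
  \sum_(i < n) x 0 (lift ord0 i) * y 0 (lift ord0 i).

(* S^n_+ (resp. H^n). *)
Definition space_form : set 'rV[R]_n.+1 :=
  [set x | form x x = curvature /\ 0 < x 0 0].

Definition pole : 'rV[R]_n.+1 := delta_mx 0 0.

(* Geodesic distance to the pole: arccos x_0 (resp. arcosh x_0). *)
Definition dist_pole (x : 'rV[R]_n.+1) : R :=
  match M with
  | Spherical => acos (x 0 0)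
  | Hyperbolic => ln (x 0 0 + Num.sqrt (x 0 0 ^+ 2 - 1))
  end.

End SpaceForm.

Section GeodesicBall.
Variables (R : realType) (n : nat) (M : geometry).
Variables (P : {vspace 'rV[R]_n.+1}) (k : nat) (r : R).

Definition geodesic_ball : set 'rV[R]_n.+1 :=
  [set x | [/\ space_form M x, dist_pole M x <= r & x \in P]].
Definition ball_interior : set 'rV[R]_n.+1 :=
  [set x | [/\ space_form M x, dist_pole M x < r & x \in P]].
Definition ball_boundary : set 'rV[R]_n.+1 :=
  [set x | [/\ space_form M x, dist_pole M x = r & x \in P]].

(* The rows of Q form an orthonormal basis of the orthogonal complement of the
   pole in P, when P contains the pole and has dimension k + 1. *)
Definition orthonormal_frame (Q : 'M[R]_(k, n.+1)) : Prop :=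
  [/\ forall i, row i Q \in P, forall i, Q i 0 = 0 & Q *m Q^T = 1%:M].

(* For such a frame, y |-> (sqrt (1 -/+ |y|^2), y) in the basis (pole, Q)
   is a global chart of the intersection of the space form with P; it contains
   the closed geodesic ball. *)
Definition graph_param (Q : 'M[R]_(k, n.+1)) (y : 'rV[R]_k) : 'rV[R]_n.+1 :=
  Num.sqrt (1 - curvature R M * (y *m y^T) 0 0) *: pole R n + y *m Q.

Definition induced_metric (Q : 'M[R]_(k, n.+1)) (y : 'rV[R]_k) : 'M[R]_k :=
  \matrix_(i, j) form M (partial i (graph_param Q) y)
                        (partial j (graph_param Q) y).

(* u solves  Delta_g u = alpha u  in the ball,  du/deta = sigma u  on its
   boundary. Only the values of u on the closed ball are relevant. *)
Definition steklov_solution (alpha sigma : R) (u : 'rV[R]_n.+1 -> R) : Prop :=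
  smooth_near geodesic_ball u /\
  forall Q : 'M[R]_(k, n.+1), orthonormal_frame Q ->
    let phi := graph_param Q in
    let g := induced_metric Q in
    let eta := conormal g (fun y => dist_pole M (phi y)) in
    (forall y, ball_interior (phi y) ->
       laplacian g (fun z => u (phi z)) y = alpha * u (phi y)) /\
    (forall y, ball_boundary (phi y) ->
       'D_(eta y) (fun z => u (phi z)) y = sigma * u (phi y)).

Definition steklov_eigenvalue (alpha sigma : R) : Prop :=
  exists u, steklov_solution alpha sigma u /\
            exists2 p, geodesic_ball p & u p != 0.

Definition free_on_ball (m : nat) (us : 'I_m -> 'rV[R]_n.+1 -> R) : Prop :=
  forall c : 'I_m -> R,
    (forall p, geodesic_ball p -> \sum_(i < m) c i * us i p = 0) ->
    forall i, c i = 0.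

(* The dimension of the space of solutions, as functions on the closed ball. *)
Definition multiplicity (alpha sigma : R) : \bar R :=
  ereal_sup [set m%:R%:E | m in [set m : nat |
    exists us : 'I_m -> 'rV[R]_n.+1 -> R,
      (forall i, steklov_solution alpha sigma (us i)) /\ free_on_ball us]].

(* cot r (resp. coth r). *)
Definition index_threshold : R :=
  match M with
  | Spherical => cos r / sin r
  | Hyperbolic => (expR r + expR (- r)) / (expR r - expR (- r))
  end.

Definition spectral_index : \bar R :=
  let alpha := curvature R M * k%:R in
  \esum_(sigma in [set sigma | steklov_eigenvalue alpha sigma /\
                               sigma < index_threshold])
    multiplicity alpha sigma.

End GeodesicBall.

(* Main.v *)
(** In the graph chart [y] of the ball, the equation [Delta u = kap k u] (with
    [kap] the curvature) is the harmonicity of the degree-one homogeneous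
    extension of [u]; the height [x_0] and the coordinates [y_i] solve it, with
    Steklov eigenvalues [- tan r] (resp. [tanh r]) and [cot r] (resp.
    [coth r]).  Let [u] be a solution with [sigma] less than the latter threshold.
    For a reflection [S] in a hyperplane orthogonal to [e], [w = u - u S] vanishes
    on the equator [e^perp].  Comparing [w] on the half ball with the strict
    supersolution [x_0 th(<y, e> / x_0)], where [th] is concave and slightly
    sublinear, the maximum principle gives [w <= 0].  Hence [u] is
    invariant under all reflections, so it is constant on the boundary sphere, and
    a second comparison shows that [u] is a multiple of [x_0].  So the only
    eigenvalue below the threshold is that of [x_0], and it is simple. *)

Require Import Defs.
From mathcomp Require Import all_boot all_order all_algebra.
From mathcomp Require Import all_classical all_reals all_analysis.
From mathcomp Require Import ring lra.
Import Order.TTheory GRing.Theory Num.Theory.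
Import numFieldNormedType.Exports.
Local Open Scope classical_set_scope.
Local Open Scope ring_scope.

(** * One-variable calculus *)

(** With [h] and [q] the height and the chart radius of the boundary sphere, the outward conormal
    there is [(h / q) y], so the Steklov condition becomes [<y, grad f> = m f] with
    [m = sigma q / h]. The threshold is [h / q] in both geometries, hence [sigma] below it means
    [m < 1]; the index bound is thus a statement about [m < 1], uniform in [kap]. On the sphere the
    zeroth-order term has the wrong sign for a direct maximum principle, so quotients by positive
    supersolutions are maximised instead. The comparison function [<y, e>] only ties: it solves the
    equation exactly and has [m = 1]. A strictly concave profile of the slope [<y, e> / x_0] gains
    strictness inside and loses a little at the boundary, and the margin [1 - m] pays for that loss.
    Both [w] and its barrier vanish on the equator, where the quotient is undefined; a smooth
    profile would leave the supremum free to be approached there. This forces a profile with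
    infinite slope at [0]. *)

Lemma is_derive_line {R : realType} {V W : normedModType R} (f : V -> W)
  (y v : V) (t : R) (df : W) :
  is_derive t 1 (fun t => f (y + t *: v)) df <-> is_derive (y + t *: v) v f df.
Proof.
have E : (fun h : R => h^-1 *: (((fun t => f (y + t *: v)) \o shift t) (h *: 1)
            - f (y + t *: v))) =
         (fun h : R => h^-1 *: ((f \o shift (y + t *: v)) (h *: v) - f (y + t *: v))).
  apply/funext => h /=; congr (_ *: (f _ - _)).
  by rewrite scalerDl scaler1 addrCA.
split=> -[h1 h2]; split.
- by move: h1; rewrite /derivable E.
- by move: h2; rewrite /derive E.
- by move: h1; rewrite /derivable -E.
- by move: h2; rewrite /derive -E.
Qed.

Lemma is_derive_line0 {R : realType} {V W : normedModType R} (f : V -> W)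
  (y v : V) (df : W) :
  is_derive (0 : R) 1 (fun t => f (y + t *: v)) df <-> is_derive y v f df.
Proof. by rewrite is_derive_line scale0r addr0. Qed.



(** Only points to the left of [x] enter, as required at a boundary contact. A negative value of
    Caratheodory's continuous difference quotient at [x] would persist nearby and put [g] above
    [g x] on the left. *)
Lemma is_derive1_le_left {R : realType} (g : R -> R) (x e d : R) :
  0 < e -> is_derive x 1 g d -> (forall t, x - e < t -> t < x -> g t <= g x) ->
  0 <= d.
Proof.
move=> e0 /is_derive1_caratheodory[h [gE ch <-]] le_g.
rewrite leNgt; apply/negP => hx0.
have /nbhs_ballP[e' /= e'0 He] : \forall z \near x, h z < 0.
  by move/cvgr_lt: ch; apply.
have [m [m0 me me']] : exists m, [/\ 0 < m, m < e & m < e'].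
  exists (Num.min e e' / 2); have : 0 < Num.min e e' by rewrite lt_min e0.
  have : Num.min e e' <= e' by rewrite ge_min lexx orbT.
  have : Num.min e e' <= e by rewrite ge_min lexx.
  by move=> *; split; lra.
have ht : h (x - m) < 0.
  by apply: He; rewrite /ball/= opprB addrC subrK gtr0_norm.
have : g (x - m) <= g x by apply: le_g; lra.
rewrite -subr_le0 gE leNgt nmulr_rgt0 //; apply/negP; rewrite negbK; lra.
Qed.

Lemma is_derive1_reflect {R : realType} (g : R -> R) (x d : R) :
  is_derive (- x) 1 g d -> is_derive x 1 (fun t => g (- t)) (- d).
Proof.
by move=> dg; rewrite -mulrN1; apply: (@is_derive1_comp R g -%R).
Qed.

(** Differentiability of [g1] at the single point [0] suffices: if [d] were positive, [g1] would be
    positive just to the right of [0], and the mean value theorem would push [g] above [g 0]. *)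
Lemma second_derivative_at_max {R : realType} (g g1 : R -> R) (e d : R) :
  0 < e -> (forall t : R, `|t| < e -> is_derive t 1 g (g1 t)) ->
  is_derive (0 : R) 1 g1 d -> (forall t, `|t| < e -> g t <= g 0) ->
  g1 0 = 0 /\ d <= 0.
Proof.
move=> e0 dg dg1 maxg.
have dg0 : is_derive (0 : R) 1 g (g1 0) by apply: dg; rewrite normr0.
have g10 : g1 0 = 0.
  apply/eqP; rewrite eq_le; apply/andP; split; last first.
    apply: (is_derive1_le_left _ _ _ _ e0 dg0) => t t1 t2.
    by apply: maxg; rewrite ltr0_norm //; lra.
  rewrite -oppr_ge0; apply: (is_derive1_le_left (fun t => g (- t)) 0 e _ e0).
    by apply: is_derive1_reflect; rewrite oppr0.
  move=> t t1 t2; rewrite oppr0; apply: maxg.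
  by rewrite normrN ltr0_norm //; lra.
split=> //; rewrite leNgt; apply/negP => d0.
move: dg1 => /is_derive1_caratheodory[h [gE ch hd]].
rewrite -hd in d0.
have /nbhs_ballP[e' /= e'0 He] : \forall z \near (0:R), 0 < h z.
  by move/cvgr_gt: ch; apply.
have [m [m0 me me']] : exists m, [/\ 0 < m, m < e & m < e'].
  exists (Num.min e e' / 2); have : 0 < Num.min e e' by rewrite lt_min e0.
  have : Num.min e e' <= e' by rewrite ge_min lexx orbT.
  have : Num.min e e' <= e by rewrite ge_min lexx.
  by move=> *; split; lra.
have in_e (t : R) : 0 <= t -> t <= m -> `|t| < e.
  by move=> t0 tm; rewrite ger0_norm //; lra.
have [||c] := @MVT R g g1 0 m m0.
- by move=> t; rewrite in_itv/= => /andP[t0 tm]; apply/dg/in_e; lra.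
- apply: derivable_within_continuous => t; rewrite in_itv/= => /andP[t0 tm].
  by have [] := dg t (in_e _ t0 tm).
rewrite in_itv/= => /andP[c0 cm] gm.
have hc : 0 < h c by apply: He; rewrite /ball/= sub0r normrN gtr0_norm //; lra.
have : g m <= g 0 by apply/maxg/in_e; lra.
have := gE c; rewrite g10 !subr0 in gm * => g1c.
have : 0 < g1 c * m by rewrite g1c !mulr_gt0.
lra.
Qed.

(** * Pointwise derivatives and the Euclidean product *)

Section PointwiseDerivatives.
Context {R : realType} {V : normedModType R}.
Implicit Types (f g : V -> R) (y v : V) (df dg : R).

Lemma is_derive_eq_real f y v df dg : is_derive y v f dg -> dg = df ->
  is_derive y v f df.
Proof. by move=> ? <-. Qed.

Lemma is_deriveD_fun f g y v df dg : is_derive y v f df -> is_derive y v g dg ->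
  is_derive y v (fun z => f z + g z) (df + dg).
Proof. exact: is_deriveD. Qed.

Lemma is_deriveN_fun f y v df : is_derive y v f df ->
  is_derive y v (fun z => - f z) (- df).
Proof. exact: is_deriveN. Qed.

Lemma is_deriveM_fun f g y v df dg : is_derive y v f df -> is_derive y v g dg ->
  is_derive y v (fun z => f z * g z) (f y * dg + g y * df).
Proof. exact: is_deriveM. Qed.

Lemma is_deriveZ_fun f (c : R) y v df : is_derive y v f df ->
  is_derive y v (fun z => c * f z) (c * df).
Proof. exact: is_deriveZ. Qed.

Lemma is_deriveZr_fun f (c : R) y v df : is_derive y v f df ->
  is_derive y v (fun z => f z * c) (df * c).
Proof.
move=> /(is_deriveZ_fun f c); rewrite mulrC.
by have -> : (fun z => c * f z) = (fun z => f z * c)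
  by apply/funext => z; rewrite mulrC.
Qed.

Lemma is_derive_cstD_fun f (c : R) y v df : is_derive y v f df ->
  is_derive y v (fun z => c + f z) df.
Proof. by move=> ?; apply: is_derive_eq; rewrite add0r. Qed.

Lemma is_derive1_comp_fun f (g : R -> R) y v df dg :
  is_derive (f y) 1 g dg -> is_derive y v f df ->
  is_derive y v (fun z => g (f z)) (dg * df).
Proof.
move=> dg1 /is_derive_line0 df1; apply/is_derive_line0.
by apply: (@is_derive1_comp R g (fun t => f (y + t *: v))) => //=; rewrite scale0r addr0.
Qed.

Lemma is_deriveV_fun f y v df : f y != 0 -> is_derive y v f df ->
  is_derive y v (fun z => (f z)^-1) (- df / f y ^+ 2).
Proof.
move=> f0 dF; apply: (is_derive_eq (f' := - (f y) ^- 2 * df)).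
  apply: is_derive1_comp_fun => //; apply: is_derive_eq.
    by apply: is_deriveV.
  by rewrite [LHS]mulr1.
by rewrite mulrC mulrN mulNr.
Qed.

Lemma is_derive_sum_fun n (f : 'I_n -> V -> R) y v (df : 'I_n -> R) :
  (forall i, is_derive y v (f i) (df i)) ->
  is_derive y v (fun z => \sum_i f i z) (\sum_i df i).
Proof.
move=> h; have -> : (fun z => \sum_i f i z) = \sum_i f i.
  by apply/funext => z; rewrite fct_sumE.
exact: is_derive_sum.
Qed.

Lemma differentiable_sum_fun n (f : 'I_n -> V -> R) y :
  (forall i, differentiable (f i) y) -> differentiable (fun z => \sum_i f i z) y.
Proof.
move=> h; have -> : (fun z => \sum_i f i z) = \sum_i f i.
  by apply/funext => z; rewrite fct_sumE.
exact: differentiable_sum.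
Qed.

End PointwiseDerivatives.

Lemma differentiable_mulmx {R : realType} {m n : nat} (S : 'M[R]_(m, n)) y :
  differentiable (fun z : 'rV[R]_m => z *m S) y.
Proof.
have -> : (fun z : 'rV[R]_m => z *m S) = \sum_i (fun z : 'rV[R]_m => z 0 i *: row i S).
  by apply/funext => z; rewrite fct_sumE mulmx_sum_row.
apply: differentiable_sum => i; apply: differentiableZl.
exact: differentiable_coord.
Qed.

Section Dot.
Context {R : realType} {k : nat}.
Implicit Types (u v w : 'rV[R]_k) (c : R).

Definition dot u v : R := (u *m v^T) 0 0.

Lemma dotE u v : dot u v = \sum_i u 0 i * v 0 i.
Proof. by rewrite /dot mxE; apply: eq_bigr => i _; rewrite mxE. Qed.

Lemma dotC u v : dot u v = dot v u.
Proof. by rewrite !dotE; apply: eq_bigr => i _; rewrite mulrC. Qed.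

Lemma dotDl u v w : dot (u + v) w = dot u w + dot v w.
Proof. by rewrite /dot mulmxDl mxE. Qed.

Lemma dotZl c u v : dot (c *: u) v = c * dot u v.
Proof. by rewrite /dot -scalemxAl mxE. Qed.

Lemma dotDr u v w : dot w (u + v) = dot w u + dot w v.
Proof. by rewrite dotC dotDl !(dotC w). Qed.

Lemma dotZr c u v : dot u (c *: v) = c * dot u v.
Proof. by rewrite dotC dotZl dotC. Qed.

Lemma dotNl u v : dot (- u) v = - dot u v.
Proof. by rewrite -scaleN1r dotZl mulN1r. Qed.

Lemma dotNr u v : dot u (- v) = - dot u v.
Proof. by rewrite dotC dotNl dotC. Qed.

Lemma dot0l v : dot 0 v = 0.
Proof. by rewrite /dot mul0mx mxE. Qed.

Lemma dot_delta u i : dot u (delta_mx 0 i) = u 0 i.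
Proof.
rewrite dotE (bigD1 i) //= mxE !eqxx mulr1 big1 ?addr0 // => j ji.
by rewrite mxE (negPf ji) andbF mulr0.
Qed.

Lemma dot_ge0 u : 0 <= dot u u.
Proof. by rewrite dotE sumr_ge0 // => i _; rewrite -expr2 sqr_ge0. Qed.

Lemma dot_eq0 u : dot u u = 0 -> u = 0.
Proof.
rewrite dotE => /eqP; rewrite psumr_eq0 => [/allP h|i _]; last first.
  by rewrite -expr2 sqr_ge0.
apply/rowP => i; rewrite mxE; apply/eqP.
by have := h i (mem_index_enum i); rewrite -expr2 sqrf_eq0.
Qed.

Lemma dot_gt0 u : u != 0 -> 0 < dot u u.
Proof.
by move=> u0; rewrite lt_neqAle dot_ge0 andbT eq_sym; apply: contra_neq u0 => /dot_eq0.
Qed.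

Lemma dot_cauchy u v : dot u v ^+ 2 <= dot u u * dot v v.
Proof.
have [->|v0] := eqVneq v 0; first by rewrite dotC !dot0l expr0n mulr0.
have v1 := dot_gt0 v v0.
have := dot_ge0 (dot v v *: u - dot u v *: v).
rewrite !(dotDl, dotDr, dotNl, dotNr, dotZl, dotZr) (dotC v u) => h.
by rewrite -(ler_pM2l v1); nra.
Qed.

Lemma is_derive_dot y v u : is_derive y v (fun z => dot z u) (dot v u).
Proof.
apply/is_derive_line0.
have -> : (fun t : R => dot (y + t *: v) u) = (fun t => dot y u + t * dot v u).
  by apply/funext => t; rewrite dotDl dotZl.
apply: is_derive_eq; rewrite /GRing.scale/=; ring.
Qed.

Lemma is_derive_dot_self y v : is_derive y v (fun z => dot z z) (2 * dot y v).
Proof.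
apply/is_derive_line0.
have -> : (fun t : R => dot (y + t *: v) (y + t *: v)) =
    (fun t => dot y y + t * (2 * dot y v + t * dot v v)).
  apply/funext => t; rewrite !(dotDl, dotDr, dotZl, dotZr) (dotC v y); ring.
apply: is_derive_eq; rewrite /GRing.scale/=; ring.
Qed.

Lemma differentiable_dotl u y : differentiable (fun z => dot z u) y.
Proof.
have -> : (fun z => dot z u) = (fun z => \sum_i z 0 i * u 0 i).
  by apply/funext => z; rewrite dotE.
apply: differentiable_sum_fun => i; apply: differentiableM => //.
exact: differentiable_coord.
Qed.

Lemma differentiable_dot_self y : differentiable (fun z : 'rV[R]_k => dot z z) y.
Proof.
have -> : (fun z => dot z z) = (fun z : 'rV[R]_k => \sum_i z 0 i * z 0 i).
  by apply/funext => z; rewrite dotE.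
by apply: differentiable_sum_fun => i; apply: differentiableM; exact: differentiable_coord.
Qed.

End Dot.

(** * Height, projective slope and barriers *)

Lemma near_line {R : realType} {V : normedModType R} (p a : V) (P : V -> Prop) :
  (\forall y \near p, P y) -> exists2 e : R, 0 < e & forall t, `|t| < e -> P (p + t *: a).
Proof.
move=> nP.
have c : (fun t : R => p + t *: a) t @[t --> (0:R)] --> p.
  rewrite -[X in _ --> X]addr0 -(scale0r a); apply: cvgD; first exact: cvg_cst.
  by apply: cvgZr_tmp => //.
have /nbhs_ballP[e /= e0 He] := c _ nP.
by exists e => // t te; apply: He; rewrite /ball/= sub0r normrN.
Qed.

Section Height.
Context {R : realType} {k : nat} (kap : R).
Implicit Types (p y a b e : 'rV[R]_k) (th : R -> R).

Definition height y : R := Num.sqrt (1 - kap * dot y y).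

Lemma height_gt0 y : (0 < height y) = (0 < 1 - kap * dot y y).
Proof. by rewrite sqrtr_gt0. Qed.

Lemma height_sqr y : 0 < height y -> height y ^+ 2 = 1 - kap * dot y y.
Proof. by rewrite height_gt0 => /ltW /sqr_sqrtr. Qed.

Lemma is_derive_height y a : 0 < height y ->
  is_derive y a height (- kap * dot y a / height y).
Proof.
move=> h0; have := h0; rewrite height_gt0 => h1.
apply: is_derive_eq_real.
  apply: (is_derive1_comp_fun (fun y => 1 - kap * dot y y)).
    exact: is_derive1_sqrt.
  apply: is_derive_cstD_fun; apply: is_deriveN_fun; apply: is_deriveZ_fun.
  exact: is_derive_dot_self.
by rewrite -[Num.sqrt _]/(height y); field; rewrite gt_eqF.
Qed.

Lemma differentiable_height y : 0 < height y -> differentiable height y.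
Proof.
rewrite height_gt0 => h1.
apply: (@differentiable_comp R _ R^o R^o (fun y => 1 - kap * dot y y) Num.sqrt).
  apply: differentiableB => //; apply: differentiableM => //.
  exact: differentiable_dot_self.
by apply/derivable1_diffP; have [] := is_derive1_sqrt h1.
Qed.

Lemma is_derive_grad_height y a b : 0 < height y ->
  is_derive y b (fun z => - kap * dot z a / height z)
    (- kap * (dot b a / height y + kap * dot y a * dot y b / height y ^+ 3)).
Proof.
move=> h0; have h0' : height y != 0 by rewrite gt_eqF.
apply: is_derive_eq_real.
  apply: is_deriveM_fun.
    by apply: is_deriveZ_fun; exact: is_derive_dot.
  apply: is_deriveV_fun => //.
  exact: is_derive_height.
by rewrite /=; field.
Qed.

Definition slope e y : R := dot y e / height y.

Lemma is_derive_slope e y a : 0 < height y ->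
  is_derive y a (slope e)
   ((dot a e + kap * slope e y * dot y a / height y) / height y).
Proof.
move=> h0; have h0' : height y != 0 by rewrite gt_eqF.
apply: is_derive_eq_real.
  apply: is_deriveM_fun; first exact: is_derive_dot.
  apply: is_deriveV_fun => //.
  exact: is_derive_height.
by rewrite /slope/=; field.
Qed.

(* The degree-one homogeneous function equal to [th] of the [e]-coordinate in the
   projective (Klein) chart. *)
Definition barrier e (th : R -> R) y : R := height y * th (slope e y).

(** The derivative of the barrier along [a], grouped so that the gradient of the height appears only
    with the factor [th z - z th' z], which vanishes for linear [th]. *)
Definition dbarrier e (th th1 : R -> R) y a : R :=
  th1 (slope e y) * dot a e +
  (th (slope e y) - slope e y * th1 (slope e y)) * (- kap * dot y a / height y).

Lemma is_derive_barrier e th th1 y a : 0 < height y ->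
  is_derive (slope e y) 1 th (th1 (slope e y)) ->
  is_derive y a (barrier e th) (dbarrier e th th1 y a).
Proof.
move=> h0 dth; have h0' : height y != 0 by rewrite gt_eqF.
apply: is_derive_eq_real.
  apply: is_deriveM_fun; first exact: is_derive_height.
  exact: (is_derive1_comp_fun (slope e) th _ _ _ _ dth (is_derive_slope e y a h0)).
by rewrite /dbarrier /slope/=; field.
Qed.

(** Since the derivative of [th z - z th' z] in [z] is [- z th'' z], the first-order terms combine
    into a rank-one term with factor [th'']; the rest is a multiple of the Hessian of the height. *)
Lemma is_derive_dbarrier e th th1 (th2 : R) y a : 0 < height y ->
  is_derive (slope e y) 1 th (th1 (slope e y)) ->
  is_derive (slope e y) 1 th1 th2 ->
  is_derive y a (fun z => dbarrier e th th1 z a)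
   (th2 * ((dot a e + kap * slope e y * dot y a / height y) ^+ 2 / height y)
   - (th (slope e y) - slope e y * th1 (slope e y)) *
     (kap * (dot a a / height y + kap * dot y a ^+ 2 / height y ^+ 3))).
Proof.
move=> h0 dth dth1; have h0' : height y != 0 by rewrite gt_eqF.
have dz := is_derive_slope e y a h0.
have d1 := is_derive1_comp_fun (slope e) th1 _ _ _ _ dth1 dz.
have d0 := is_derive1_comp_fun (slope e) th _ _ _ _ dth dz.
have dE := is_deriveD_fun _ _ _ _ _ _ d0
  (is_deriveN_fun _ _ _ _ (is_deriveM_fun _ _ _ _ _ _ dz d1)).
apply: (is_derive_eq_real _ _ _ _ _ (is_deriveD_fun _ _ _ _ _ _
  (is_deriveZr_fun _ (dot a e) _ _ _ d1)
  (is_deriveM_fun _ _ _ _ _ _ dE (is_derive_grad_height y a a h0)))).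
by rewrite /=; field.
Qed.

End Height.

(** * Contact lemmas *)

Section InverseMetricTrace.
Context {R : realType} {k : nat} (kap : R).
Implicit Types (p u v a : 'rV[R]_k) (X : 'M[R]_k).

Lemma dot_outer a b u : dot (a *m (u^T *m u)) b = dot a u * dot u b :> R.
Proof. by rewrite /dot -!mulmxA mulmxA mxE big_ord1. Qed.

Lemma trace_outer u : \tr (u^T *m u) = dot u u :> R.
Proof. by rewrite mxtrace_mulC trace_mx11. Qed.

(* [1 - kap p^T p] is the inverse metric; it factors as [A^T A]. *)
Lemma inverse_metric_trace_ge0 p X : 0 < height kap p ->
  (forall a, 0 <= dot (a *m X) a) -> 0 <= \tr X - kap * dot (p *m X) p.
Proof.
move=> h0 X0; have hsq := height_sqr _ _ h0; set h := height kap p in h0 hsq.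
have h1 : 1 + h != 0 by rewrite gt_eqF; lra.
(* [A] is the symmetric square root of the inverse metric: on the line of [p] it acts as
   [1 - c |p|^2 = h], where the inverse metric acts as [1 - kap |p|^2 = h^2]. *)
pose c := kap / (1 + h); pose A : 'M[R]_k := 1%:M - c *: (p^T *m p).
have AA : A^T *m A = 1%:M - kap *: (p^T *m p).
  have At : A^T = A by rewrite /A linearB /= linearZ /= trmx_mul trmxK trmx1.
  have E : (p^T *m p) *m (p^T *m p) = dot p p *: (p^T *m p).
    rewrite mulmxA -(mulmxA _ p) [p *m p^T]mx11_scalar -/(dot p p).
    by rewrite mul_mx_scalar -scalemxAl.
  rewrite At /A mulmxBl mul1mx mulmxBr mulmx1 -scalemxAl -scalemxAr E !scalerA.
  have -> : kap = c + c - c * (c * dot p p).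
    have pp : kap * dot p p = 1 - h ^+ 2 by rewrite hsq; ring.
    have -> : c * (c * dot p p) = kap * (1 - h ^+ 2) / (1 + h) ^+ 2.
      by rewrite -pp /c; field.
    by rewrite /c; field.
  by rewrite scalerBl scalerDl mulrA !opprB opprD !addrA (addrAC 1%:M).
have -> : \tr X - kap * dot (p *m X) p = \tr (A *m X *m A^T).
  rewrite -mulmxA [RHS]mxtrace_mulC -mulmxA AA mulmxBr mulmx1 linearB /=.
  by rewrite -scalemxAr mxtraceZ mulmxA mxtrace_mulC mulmxA trace_mx11.
rewrite /mxtrace sumr_ge0 // => i _.
have -> : (A *m X *m A^T) i i = dot (row i A *m X) (row i A).
  rewrite /dot -row_mul !mxE; apply: eq_bigr => j _; rewrite !mxE.
  by congr (_ * _); apply: eq_bigr => l _; rewrite !mxE.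
exact: X0.
Qed.

End InverseMetricTrace.

Section MaximumPrinciple.
Context {R : realType} {k : nat} (kap : R) (e : 'rV[R]_k) (th th1 : R -> R).
Hypothesis kap2 : kap ^+ 2 = 1.
Implicit Types (p y a b : 'rV[R]_k) (f : 'rV[R]_k -> R) (X : 'M[R]_k).

Local Notation H := (barrier kap e th).
Local Notation slp := (slope kap e).

(* With [z] the slope, the operator of the equation sends the barrier to
   [th''(z) (|e|^2 + kap z^2) / height], which is negative as [th] is strictly
   concave; at an interior contact point this contradicts the second-order
   conditions. *)
Lemma no_interior_contact f (Df : 'rV[R]_k -> 'rV[R]_k) p X (M th2 : R) :
  e != 0 -> 0 < M ->
  (\forall y \near p, [/\ 0 < height kap y,
     forall a, is_derive y a f (dot (Df y) a),
     is_derive (slp y) 1 th (th1 (slp y)) & f y <= M * H y]) ->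
  (forall a, is_derive p a (fun y => dot (Df y) a) (dot (a *m X) a)) ->
  is_derive (slp p) 1 th1 th2 -> th2 < 0 ->
  f p = M * H p ->
  \tr X - kap * dot (p *m X) p - kap * k%:R * (dot (Df p) p - f p) = 0 ->
  False.
Proof.
move=> e0 M0 Np dDf dth1 th20 fp eqp.
have [h0 df dth _] := nbhs_singleton Np.
have hsq := height_sqr _ _ h0.
set h := height kap p in h0 hsq; set z := slp p in dth dth1.
have h0' : h != 0 by rewrite gt_eqF.
pose w := th z - z * th1 z.
pose D2 a := th2 * ((dot a e + kap * z * dot p a / h) ^+ 2 / h)
   - w * (kap * (dot a a / h + kap * dot p a ^+ 2 / h ^+ 3)).
(* On every line through [p] the difference [f - M H] is maximal at [p]: the gradients agree, and
   the Hessian of [f] lies below that of [M H]. *)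
have key a : dot (Df p) a = M * dbarrier kap e th th1 p a /\
     dot (a *m X) a <= M * D2 a.
  have [eps eps0 Heps] := near_line _ a _ Np.
  pose g t := f (p + t *: a) + - M * H (p + t *: a).
  pose g1 t := dot (Df (p + t *: a)) a + - M * dbarrier kap e th th1 (p + t *: a) a.
  have dg (t : R) : `|t| < eps -> is_derive t 1 g (g1 t).
    move=> /Heps[ht dft dtht _].
    apply/(is_derive_line (fun y => f y + - M * H y)).
    exact: (is_deriveD_fun _ _ _ _ _ _ (dft a)
      (is_deriveZ_fun _ (- M) _ _ _ (is_derive_barrier _ _ _ _ _ a ht dtht))).
  have dg1 : is_derive (0 : R) 1 g1 (dot (a *m X) a + - M * D2 a).
    apply/(is_derive_line0 (fun y => dot (Df y) a + - M * dbarrier kap e th th1 y a)).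
    exact: (is_deriveD_fun _ _ _ _ _ _ (dDf a)
      (is_deriveZ_fun _ (- M) _ _ _ (is_derive_dbarrier _ _ _ _ _ _ a h0 dth dth1))).
  have maxg (t : R) : `|t| < eps -> g t <= g 0.
    move=> /Heps[_ _ _ ft].
    by rewrite /g scale0r addr0 fp; lra.
  have [] := second_derivative_at_max _ _ _ _ eps0 dg dg1 maxg.
  by rewrite /g1 scale0r addr0; split; lra.
have [Dpp _] := key p.
(* [<a, zeta>] is [h] times the derivative of the slope along [a]. [Y] is the matrix of the
   nonnegative form [M D2 - X], written with outer products so that its trace is explicit. *)
pose zeta := e + (kap * z / h) *: p.
pose Y : 'M[R]_k := (M * th2 / h) *: (zeta^T *m zeta)
  - (M * w * kap / h) *: 1%:M - (M * w * kap ^+ 2 / h ^+ 3) *: (p^T *m p) - X.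
have dotY a b : dot (a *m Y) b = M * th2 / h * (dot a zeta * dot zeta b)
  - M * w * kap / h * dot a b
  - M * w * kap ^+ 2 / h ^+ 3 * (dot a p * dot p b) - dot (a *m X) b.
  rewrite /Y !mulmxBr -!scalemxAr mulmx1.
  by rewrite !(dotDl _ _ b, dotNl _ b, dotZl) !dot_outer -/zeta (dotDl e) dotZl.
have Y0 a : 0 <= dot (a *m Y) a.
  have -> : dot (a *m Y) a = M * D2 a - dot (a *m X) a.
    rewrite dotY /D2 /zeta !(dotDr, dotDl, dotZr, dotZl) (dotC e a) (dotC a p).
    by field.
  by rewrite subr_ge0; have [] := key a.
have := inverse_metric_trace_ge0 _ _ _ h0 Y0.
rewrite dotY.
have -> : \tr Y = M * th2 / h * dot zeta zeta - M * w * kap / h * k%:R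
   - M * w * kap ^+ 2 / h ^+ 3 * dot p p - \tr X.
  by rewrite /Y !linearB /= !linearZ /= !trace_outer mxtrace1.
have -> : \tr X = kap * dot (p *m X) p + kap * k%:R * (dot (Df p) p - f p).
  by lra.
rewrite Dpp fp /dbarrier /barrier -/z -/h.
have pe : dot p e = z * h by rewrite /z /slope -/h mulfVK.
have pp : dot p p = kap * (1 - h ^+ 2).
  by rewrite hsq opprB addrC subrK mulrA -expr2 kap2 mul1r.
have thz : th z = w + z * th1 z by rewrite /w subrK.
rewrite -/w (dotC zeta p) !(dotDl, dotDr, dotZl, dotZr) (dotC e p) pe pp thz.
(* For [kap = -1], Cauchy-Schwarz reads [(z h)^2 <= (h^2 - 1) |e|^2], so [z^2 < |e|^2]. *)
have pos : 0 < dot e e + kap * z ^+ 2.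
  have e1 := dot_gt0 _ e0; have cs := dot_cauchy p e; rewrite pe pp in cs.
  by have /eqP := kap2; rewrite sqrf_eq1 => /orP[]/eqP k1; rewrite k1 in cs *; nra.
have neg : M * th2 / h * (dot e e + kap * z ^+ 2) < 0.
  by rewrite pmulr_llt0 // pmulr_llt0 ?invr_gt0 // pmulr_rlt0.
(* The terms in [w] and [th1 z] cancel, because the height and the linear coordinates solve the
   equation; only the [th''] term is left. *)
move=> nonneg; suff : 0 <= M * th2 / h * (dot e e + kap * z ^+ 2).
  by rewrite leNgt neg.
apply: le_trans nonneg _; rewrite le_eqVlt; apply/orP; left; apply/eqP.
by have /eqP := kap2; rewrite sqrf_eq1 => /orP[]/eqP ->; field.
Qed.

(** Along the ray through [p], [f - M H] reaches its maximum [0] at [p] from inside, so its radial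
    derivative there is nonnegative; this caps the radial derivative of the barrier by [m H]. *)
Lemma no_boundary_contact f p (M m d : R) :
  0 < M -> 0 < height kap p -> is_derive (slp p) 1 th (th1 (slp p)) ->
  is_derive p p f (m * f p) -> f p = M * H p ->
  0 < d -> (forall t, 1 - d < t -> t < 1 -> f (t *: p) <= M * H (t *: p)) ->
  m * H p < dbarrier kap e th th1 p p ->
  False.
Proof.
move=> M0 h0 dth df fp d0 le_f lt_m.
pose g t := f (p + t *: p) + - M * H (p + t *: p).
have dg : is_derive (0 : R) 1 g (m * f p + - M * dbarrier kap e th th1 p p).
  apply/(is_derive_line0 (fun y => f y + - M * H y)).
  exact: (is_deriveD_fun _ _ _ _ _ _ df
    (is_deriveZ_fun _ (- M) _ _ _ (is_derive_barrier _ _ _ _ _ p h0 dth))).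
have : 0 <= m * f p + - M * dbarrier kap e th th1 p p.
  apply: (is_derive1_le_left _ _ _ _ d0 dg) => t; rewrite sub0r => t1 t2.
  have E : p + t *: p = (1 + t) *: p by rewrite scalerDl scale1r.
  rewrite /g scale0r addr0 fp E.
  by have := le_f (1 + t); lra.
by rewrite fp mulrCA mulNr subr_ge0 ler_pM2l // leNgt lt_m.
Qed.

End MaximumPrinciple.

(** * Compactness of the closed chart ball and maxima of quotients *)

Section ClosedBall.
Context {R : realType} {k : nat} (s2 : R).
Implicit Types (y : 'rV[R]_k).


Lemma compact_dot_ball : compact [set y : 'rV[R]_k | dot y y <= s2].
Proof.
apply: bounded_closed_compact.
  exists (1 + `|s2|); split; first by rewrite realE; apply/orP; left; apply: addr_ge0.
  move=> M s2M y /= ys; rewrite [X in X <= _]mx_normrE.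
  apply: bigmax_le => [|[i j] _]; first by have := normr_ge0 s2; lra.
  rewrite (ord1 i) /=; have yj : y 0 j ^+ 2 <= dot y y.
    rewrite dotE (bigD1 j) //= expr2 lerDl sumr_ge0 // => l _.
    by rewrite -expr2 sqr_ge0.
  have := ler_norm s2; have := normr_ge0 (y 0 j); have := real_normK (num_real (y 0 j)).
  by nra.
rewrite (_ : [set y | dot y y <= s2] = (fun y : 'rV[R]_k => dot y y) @^-1` [set x | x <= s2]) //.
apply: closed_comp; last exact: closed_le.
by move=> y _; apply: differentiable_continuous; exact: differentiable_dot_self.
Qed.

End ClosedBall.

(** [M] is the maximum of [f / g]: the least multiple of [g] above [f], which touches [f] at [p]. *)
Lemma exists_max_ratio {R : realType} {k : nat} (K : set 'rV[R]_k)
  (f g : 'rV[R]_k -> R) (p0 : 'rV[R]_k) :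
  compact K -> K p0 -> (forall y, K y -> {for y, continuous f}) ->
  (forall y, K y -> {for y, continuous g}) -> (forall y, K y -> 0 < g y) ->
  exists p M, [/\ K p, f p = M * g p, f p0 / g p0 <= M &
    forall y, K y -> f y <= M * g y].
Proof.
move=> cK Kp0 cf cg g0.
have [|||p pK pmax] := @EVT_max_rV R k (fun y => f y / g y) K => //.
- by exists p0.
- apply: continuous_in_subspaceT => y /set_mem Ky.
  have gy0 : g y != 0 by rewrite gt_eqF ?g0.
  exact: (cvgM (cf y Ky) (cvgV gy0 (cg y Ky))).
exists p, (f p / g p); have Kp := set_mem pK.
split => //.
- by rewrite mulfVK ?gt_eqF ?g0.
- by apply: pmax; apply: mem_set.
- move=> y Ky; rewrite -ler_pdivrMr ?g0 //; by apply: pmax; apply: mem_set.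
Qed.

(** * The equation in the graph chart *)

Section Equation.
Context {R : realType} {k : nat} (kap s2 : R).
Hypothesis kap2 : kap ^+ 2 = 1.
Hypothesis ks2 : 0 < 1 - kap * s2.
Implicit Types (p y a b e : 'rV[R]_k) (f : 'rV[R]_k -> R) (m : R).

(* Row [i] of [Hf y] is the derivative of the gradient [Df] in the [i]-th direction. *)
Definition C2_data f (Df : 'rV[R]_k -> 'rV[R]_k) (Hf : 'rV[R]_k -> 'M[R]_k) : Prop :=
  forall y, dot y y <= s2 -> [/\ {for y, continuous f},
    forall a, is_derive y a f (dot (Df y) a),
    forall a, {for y, continuous (fun z => dot (Df z) a)} &
    forall a b, is_derive y b (fun z => dot (Df z) a) (dot (b *m Hf y) a)].

(* [Delta_g f = kap k f] in the graph chart, where the inverse metric is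
   [1 - kap y^T y] and the square root of the determinant is [1 / height]. *)
Definition chart_equation f : Prop :=
  exists Df Hf, C2_data f Df Hf /\ forall y, dot y y < s2 ->
   \tr (Hf y) - kap * dot (y *m Hf y) y - kap * k%:R * (dot (Df y) y - f y) = 0.

Definition radial_condition m f : Prop :=
  forall y, dot y y = s2 -> is_derive y y f (m * f y).

Lemma chart_equation_lincomb c1 c2 f1 f2 : chart_equation f1 -> chart_equation f2 ->
  chart_equation (fun y => c1 * f1 y + c2 * f2 y).
Proof.
move=> [D1 [H1 [d1 E1]]] [D2 [H2 [d2 E2]]].
exists (fun y => c1 *: D1 y + c2 *: D2 y), (fun y => c1 *: H1 y + c2 *: H2 y).
split=> y ys; last first.
  rewrite mulmxDr -!scalemxAr !(dotDl, dotZl) linearD /= !mxtraceZ.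
  have := E1 y ys; have := E2 y ys.
  set t1 := \tr (H1 y); set t2 := \tr (H2 y) => e2 e1.
  have -> : t1 = kap * dot (y *m H1 y) y + kap * k%:R * (dot (D1 y) y - f1 y) by lra.
  have -> : t2 = kap * dot (y *m H2 y) y + kap * k%:R * (dot (D2 y) y - f2 y) by lra.
  ring.
have [cf1 df1 cd1 dd1] := d1 y ys; have [cf2 df2 cd2 dd2] := d2 y ys.
have Ef (g1 g2 : 'rV[R]_k -> R) : {for y, continuous g1} -> {for y, continuous g2} ->
   {for y, continuous (fun z => c1 * g1 z + c2 * g2 z)}.
  move=> h1 h2; exact: (cvgD (cvgM (cvg_cst _) h1) (cvgM (cvg_cst _) h2)).
split.
- exact: Ef.
- move=> a; rewrite dotDl !dotZl.
  exact: (is_deriveD_fun _ _ _ _ _ _ (is_deriveZ_fun _ c1 _ _ _ (df1 a))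
    (is_deriveZ_fun _ c2 _ _ _ (df2 a))).
- move=> a; have -> : (fun z => dot (c1 *: D1 z + c2 *: D2 z) a) =
    (fun z => c1 * dot (D1 z) a + c2 * dot (D2 z) a).
    by apply/funext => z; rewrite dotDl !dotZl.
  exact: Ef.
- move=> a b; have -> : (fun z => dot (c1 *: D1 z + c2 *: D2 z) a) =
    (fun z => c1 * dot (D1 z) a + c2 * dot (D2 z) a).
    by apply/funext => z; rewrite dotDl !dotZl.
  rewrite mulmxDr -!scalemxAr dotDl !dotZl.
  exact: (is_deriveD_fun _ _ _ _ _ _ (is_deriveZ_fun _ c1 _ _ _ (dd1 a b))
    (is_deriveZ_fun _ c2 _ _ _ (dd2 a b))).
Qed.

Lemma radial_condition_lincomb m c1 c2 f1 f2 :
  radial_condition m f1 -> radial_condition m f2 ->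
  radial_condition m (fun y => c1 * f1 y + c2 * f2 y).
Proof.
move=> r1 r2 y ys.
apply: (is_derive_eq_real _ _ _ _ _ (is_deriveD_fun _ _ _ _ _ _
  (is_deriveZ_fun _ c1 _ _ _ (r1 y ys)) (is_deriveZ_fun _ c2 _ _ _ (r2 y ys)))).
by ring.
Qed.

(** * Invariance under symmetric involutions of the chart *)

Section Reflection.
Context (S : 'M[R]_k) (ST : S^T = S) (SS : S *m S = 1%:M).

Lemma dot_mulmx y a : dot (y *m S) a = dot y (a *m S).
Proof. by rewrite /dot trmx_mul ST mulmxA. Qed.

Lemma dot_mulmx2 y a : dot (y *m S) (a *m S) = dot y a.
Proof. by rewrite dot_mulmx -mulmxA SS mulmx1. Qed.

Lemma is_derive_mulmx f y a df : is_derive (y *m S) (a *m S) f df ->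
  is_derive y a (fun z => f (z *m S)) df.
Proof.
move=> /is_derive_line0 d; apply/is_derive_line0.
have -> : (fun t : R => f ((y + t *: a) *m S)) = (fun t => f (y *m S + t *: (a *m S))).
  by apply/funext => t; rewrite mulmxDl scalemxAl.
exact: d.
Qed.

Lemma continuous_mulmx (g : 'rV[R]_k -> R) y : {for (y *m S), continuous g} ->
  {for y, continuous (fun z : 'rV[R]_k => g (z *m S))}.
Proof.
move=> cg; have cS : {for y, continuous (fun z : 'rV[R]_k => z *m S)}.
  exact/differentiable_continuous/differentiable_mulmx.
exact: (@continuous_comp _ _ _ (fun z : 'rV[R]_k => z *m S) g y cS cg).
Qed.

Lemma chart_equation_mulmx f : chart_equation f -> chart_equation (fun y => f (y *m S)).
Proof.
move=> [Df [Hf [d E]]].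
exists (fun y => Df (y *m S) *m S), (fun y => S *m Hf (y *m S) *m S).
split=> y ys; last first.
  have := E (y *m S); rewrite dot_mulmx2 => /(_ ys).
  have -> : \tr (S *m Hf (y *m S) *m S) = \tr (Hf (y *m S)).
    by rewrite mxtrace_mulC mulmxA SS mul1mx.
  by rewrite !mulmxA !dot_mulmx.
have := d (y *m S); rewrite dot_mulmx2 => /(_ ys)[cf df cd dd].
split.
- exact: continuous_mulmx.
- by move=> a; apply: is_derive_mulmx; rewrite dot_mulmx.
- move=> a; have -> : (fun z => dot (Df (z *m S) *m S) a) =
    (fun z => dot (Df (z *m S)) (a *m S)) by apply/funext => z; rewrite dot_mulmx.
  exact: (continuous_mulmx (fun z => dot (Df z) (a *m S))).
- move=> a b; have -> : (fun z => dot (Df (z *m S) *m S) a) =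
    (fun z => dot (Df (z *m S)) (a *m S)) by apply/funext => z; rewrite dot_mulmx.
  apply: (is_derive_mulmx (fun z => dot (Df z) (a *m S))).
  by rewrite !mulmxA dot_mulmx.
Qed.

Lemma radial_condition_mulmx m f : radial_condition m f ->
  radial_condition m (fun y => f (y *m S)).
Proof. by move=> r y ys; apply/is_derive_mulmx/r; rewrite dot_mulmx2. Qed.

End Reflection.

Lemma chart_equation_height : chart_equation (height kap).
Proof.
have hb y : dot y y <= s2 -> 0 < height kap y.
  by rewrite height_gt0; have /eqP := kap2; have := dot_ge0 y;
  rewrite sqrf_eq1 => y0 /orP[]/eqP k1; move: ks2; rewrite k1; lra.
exists (fun y => (- kap / height kap y) *: y),
  (fun y => (- kap / height kap y) *: 1%:M - (kap ^+ 2 / height kap y ^+ 3) *: (y^T *m y)).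
have E a : (fun z => dot ((- kap / height kap z) *: z) a) =
    (fun z => - kap * dot z a / height kap z).
  by apply/funext => z; rewrite dotZl; ring.
split=> y ys.
  have h0 := hb y ys; split.
  - exact/differentiable_continuous/differentiable_height.
  - by move=> a; apply: (is_derive_eq_real _ _ _ _ _ (is_derive_height _ _ a h0)); rewrite dotZl; ring.
  - move=> a; rewrite E; have h0' : height kap y != 0 by rewrite gt_eqF.
    have ch : {for y, continuous (height kap)}.
      exact/differentiable_continuous/differentiable_height.
    have ca : {for y, continuous (fun z => dot z a)}.
      exact/differentiable_continuous/differentiable_dotl.
    exact: (cvgM (cvgM (cvg_cst _) ca) (cvgV h0' ch)).
  - move=> a b; rewrite E.
    apply: (is_derive_eq_real _ _ _ _ _ (is_derive_grad_height _ y a b h0)).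
    rewrite mulmxBr -!scalemxAr mulmx1 dotDl dotNl !dotZl dot_outer (dotC b y).
    by field; rewrite gt_eqF.
have h0 := hb y (ltW ys); have hsq := height_sqr _ _ h0.
rewrite mulmxBr -!scalemxAr mulmx1 dotDl dotNl !dotZl dot_outer.
rewrite linearB /= !mxtraceZ mxtrace1 trace_outer.
set h := height kap y in h0 hsq *.
have -> : dot y y = kap * (1 - h ^+ 2).
  by rewrite hsq opprB addrC subrK mulrA -expr2 kap2 mul1r.
have h0' : h != 0 by rewrite gt_eqF.
by have /eqP := kap2; rewrite sqrf_eq1 => /orP[]/eqP ->; field.
Qed.

End Equation.

(** * Comparison *)

Section Comparison.
Context {R : realType} {k : nat} (kap s2 : R).
Hypothesis s2_gt0 : 0 < s2.
Hypothesis kap2 : kap ^+ 2 = 1.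
Hypothesis ks2 : 0 < 1 - kap * s2.
Implicit Types (p y a b e : 'rV[R]_k) (f w : 'rV[R]_k -> R) (m : R).

Local Notation equation := (chart_equation kap s2).
Local Notation radial := (radial_condition s2).

Lemma height_lb : exists c, [/\ 0 < c, c <= 1 &
  forall y, dot y y <= s2 -> c <= height kap y].
Proof.
(* No square root is taken: [c <= 1] and [c <= h^2] already give [c <= h]. *)
pose c := Num.min 1 (1 - kap * s2).
have c0 : 0 < c by rewrite lt_min ltr01.
have c1 : c <= 1 by rewrite ge_min lexx.
have ck : c <= 1 - kap * s2 by rewrite ge_min lexx orbT.
exists c; split=> // y ys.
have E : c <= 1 - kap * dot y y.
  have y0 := dot_ge0 y; have /eqP := kap2.
  by rewrite sqrf_eq1 => /orP[]/eqP k1; rewrite k1 in ck *; lra.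
have h0 : 0 < height kap y by rewrite height_gt0; lra.
rewrite -(height_sqr _ _ h0) in E.
by nra.
Qed.

Lemma height_gt0_ball y : dot y y <= s2 -> 0 < height kap y.
Proof. by move=> ys; have [c [c0 _ h]] := height_lb; have := h y ys; lra. Qed.

Lemma slope_ub e : exists Z, forall y, dot y y <= s2 ->
  slope kap e y <= Z /\ slope kap e y ^+ 2 <= Z.
Proof.
have [c [c0 c1 hc]] := height_lb.
(* The summand [1] lets one constant bound both [z^2] and [z <= 1 + z^2]; the quadratic profile uses
   the former, the logarithmic one the latter. *)
exists (1 + s2 * dot e e / c ^+ 2) => y ys.
have h0 := height_gt0_ball y ys.
have le2 : slope kap e y ^+ 2 <= s2 * dot e e / c ^+ 2.
  rewrite /slope exprMn exprVn; apply: ler_pM; rewrite ?invr_ge0 ?sqr_ge0 //.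
    by apply: le_trans (dot_cauchy y e) _; apply: ler_wpM2r => //; exact: dot_ge0.
  rewrite lef_pV2 ?posrE ?exprn_gt0 // lerXn2r ?nnegrE //; last exact: hc.
    exact: ltW.
  exact: ltW.
by split; nra.
Qed.

Lemma near_interior p : dot p p < s2 -> \forall y \near p, dot y y < s2.
Proof.
have c : {for p, continuous (fun y : 'rV[R]_k => dot y y)}.
  exact/differentiable_continuous/differentiable_dot_self.
by move=> ps; move/cvgr_lt: c; apply.
Qed.

Lemma near_dot_gt p e (d : R) : d < dot p e -> \forall y \near p, d < dot y e.
Proof.
have c : {for p, continuous (fun y : 'rV[R]_k => dot y e)}.
  exact/differentiable_continuous/differentiable_dotl.
by move=> pd; move/cvgr_gt: c; apply.
Qed.

Lemma continuous_barrier e th d y : 0 < height kap y ->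
  is_derive (slope kap e y) 1 th d -> {for y, continuous (barrier kap e th)}.
Proof.
move=> h0 dth; have h0' : height kap y != 0 by rewrite gt_eqF.
have ch : {for y, continuous (height kap)}.
  exact/differentiable_continuous/differentiable_height.
have ca : {for y, continuous (fun z => dot z e)}.
  exact/differentiable_continuous/differentiable_dotl.
have cs : {for y, continuous (slope kap e)} by exact: (cvgM ca (cvgV h0' ch)).
have ct : {for slope kap e y, continuous th}.
  by apply/differentiable_continuous/derivable1_diffP; case: dth.
exact: (cvgM ch (continuous_comp cs ct)).
Qed.

(** [D] restricts the profile and the comparison to a neighbourhood of the contact point, so that
    the logarithmic profile can be used where the slope is positive. *)
Lemma equation_contact e th th1 w (D : set 'rV[R]_k) p (M th2 : R) :
  e != 0 -> 0 < M -> equation w -> dot p p < s2 ->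
  (\forall y \near p, D y) ->
  (forall y, D y -> dot y y <= s2 -> is_derive (slope kap e y) 1 th (th1 (slope kap e y))) ->
  (forall y, D y -> dot y y <= s2 -> w y <= M * barrier kap e th y) ->
  is_derive (slope kap e p) 1 th1 th2 -> th2 < 0 ->
  w p = M * barrier kap e th p -> False.
Proof.
move=> e0 M0 [Df [Hf [d E]]] ps nD dth le_w dth1 th20 wp.
have [_ _ _ dp] := d p (ltW ps).
apply: (no_interior_contact kap e th th1 kap2 w Df p (Hf p) M th2 e0 M0 _
  (fun a => dp a a) dth1 th20 wp (E p ps)).
near=> y; have Dy : D y by near: y.
have ys : dot y y <= s2 by apply: ltW; near: y; exact: near_interior.
have [_ dy _ _] := d y ys; split=> //; [exact: height_gt0_ball|exact: dth|exact: le_w].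
Unshelve. all: by end_near. Qed.

(** The height (constant profile) solves the equation and would only tie. Bending the profile to
    [Z + 1 - z^2] makes it strict, and [z^2 <= Z] keeps it positive on the closed ball. A positive
    maximal quotient is then excluded inside by strictness and on the boundary by [w = 0]. *)
Lemma equation_dirichlet_le0 e w : e != 0 -> equation w ->
  (forall y, dot y y = s2 -> w y = 0) -> forall y, dot y y <= s2 -> w y <= 0.
Proof.
move=> e0 eqw w0 y0 y0s; rewrite leNgt; apply/negP => wy0.
have [Z hZ] := slope_ub e.
pose th (x : R) := Z + 1 + - (x * x); pose th1 (x : R) := - 2 * x.
have dth (x : R) : is_derive x 1 th (th1 x).
  apply: is_derive_eq; rewrite /th1 /GRing.scale/=; ring.
have dth1 (x : R) : is_derive x 1 th1 (- 2).
  apply: is_derive_eq; rewrite /GRing.scale/=; ring.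
have barrier_gt0 y : dot y y <= s2 -> 0 < barrier kap e th y.
  move=> ys; apply: mulr_gt0; first exact: height_gt0_ball.
  by have [_] := hZ y ys; rewrite /th expr2; lra.
have [||p [M [ps wp leM le_w]]] := exists_max_ratio [set y | dot y y <= s2] w
  (barrier kap e th) y0 (compact_dot_ball s2) y0s _ _ barrier_gt0.
- by move=> y ys; have [Df [Hf [d _]]] := eqw; have [] := d y ys.
- by move=> y ys; apply: continuous_barrier (dth _); exact: height_gt0_ball.
have M0 : 0 < M by apply: lt_le_trans leM; rewrite divr_gt0 // barrier_gt0.
have [psE|ps'] := eqVneq (dot p p) s2.
  have := w0 p psE; rewrite wp => /eqP; rewrite mulf_eq0 !gt_eqF //.
  exact: barrier_gt0.
have {}ps : dot p p < s2 by rewrite lt_neqAle ps' ps.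
apply: (equation_contact e th th1 w setT p M (- 2)) => //.
- exact: filterT.
- by move=> y _ ys; exact: le_w.
Qed.

(* The profile [z (L - ln z)] has infinite slope at [0], so the quotient of [w] by
   the barrier tends to [0] at the equator; for [L] large its logarithmic radial
   derivative on the boundary exceeds [m]. *)
Lemma equation_half_ball_le0 m e w : m < 1 -> e != 0 -> equation w -> radial m w ->
  (forall y, dot y y <= s2 -> dot y e = 0 -> w y = 0) ->
  forall y, dot y y <= s2 -> 0 < dot y e -> w y <= 0.
Proof.
move=> m1 e0 eqw rw w0 y0 y0s y0e; rewrite leNgt; apply/negP => wy0.
have [Df [Hf [d E]]] := eqw; have ee := dot_gt0 e e0.
have [C hC] : exists C, forall y, dot y y <= s2 -> dot (Df y) e <= C.
  have [|||p _ hp] := @EVT_max_rV R k (fun y => dot (Df y) e) [set y | dot y y <= s2].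
  - by exists y0.
  - exact: compact_dot_ball.
  - by apply: continuous_in_subspaceT => y /set_mem ys; have [_ _ h _] := d y ys; exact: h.
  by exists (dot (Df p) e) => y ys; apply: hp; apply: mem_set.
(* [w] vanishes at the orthogonal projection of [y] to the equator, so the mean value theorem along
   [e] bounds it linearly in the distance to the equator. *)
have w_le y : dot y y <= s2 -> 0 < dot y e -> w y <= C * (dot y e / dot e e).
  move=> ys ye; set tau := dot y e / dot e e.
  have tau0 : 0 < tau by rewrite divr_gt0.
  have [z [ze yE]] : exists z, dot z e = 0 /\ y = z + tau *: e.
    exists (y + (- tau) *: e); rewrite scaleNr subrK; split=> //.
    by rewrite dotDl dotNl dotZl divfK ?subrr // gt_eqF.
  have in_ball t : 0 <= t -> t <= tau -> dot (z + t *: e) (z + t *: e) <= s2.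
    move=> t0 tt; apply: le_trans ys; rewrite yE.
    have tt2 : t * t <= tau * tau by nra.
    have := ler_wpM2r (ltW ee) tt2.
    by rewrite !(dotDl, dotDr, dotZl, dotZr) (dotC e z) ze; lra.
  have dg (t : R) : 0 <= t -> t <= tau ->
      is_derive t 1 (fun t => w (z + t *: e)) (dot (Df (z + t *: e)) e).
    move=> t0 tt; apply/is_derive_line.
    by have [_ h _ _] := d _ (in_ball t t0 tt); exact: h.
  have [|| c] := @MVT R (fun t => w (z + t *: e)) (fun t => dot (Df (z + t *: e)) e) 0 tau tau0.
  - by move=> t; rewrite in_itv/= => /andP[t0 tt]; apply: dg; exact: ltW.
  - apply: derivable_within_continuous => t; rewrite in_itv/= => /andP[t0 tt].
    by have [] := dg t t0 tt.
  rewrite in_itv/= => /andP[/ltW c0 /ltW ct].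
  have z0 : w z = 0.
    by apply: w0 ze; have := in_ball 0 (lexx _) (ltW tau0); rewrite scale0r addr0.
  rewrite -yE scale0r addr0 z0 !subr0 => ->.
  by rewrite ler_pM2r //; apply/hC/in_ball.
have [c [c0 c1 hc]] := height_lb; have [Z hZ] := slope_ub e.
(* With [l = L - ln z] and [h^2 = 1 - kap s2], the logarithmic radial derivative of the barrier on
   the boundary is [1 - 1 / (h^2 l)], which exceeds [m] once [l] is larger than the last summand.
   [Z + 1] absorbs [ln z < z <= Z]. *)
pose L := Z + 1 + ((1 - m) * (1 - kap * s2))^-1.
pose th (x : R) := x * (L - ln x); pose th1 (x : R) := L - ln x - 1.
have dth (x : R) : 0 < x -> is_derive x 1 th (th1 x).
  move=> x0; apply: (is_derive_eq_real _ _ _ _ _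
    (is_deriveM_fun _ _ _ _ _ _ (is_derive_id x 1)
     (is_derive_cstD_fun _ L _ _ _ (is_deriveN_fun _ _ _ _ (is_derive1_ln x0))))).
  by rewrite /th1 /=; field; rewrite gt_eqF.
have dth1 (x : R) : 0 < x -> is_derive x 1 th1 (- x^-1).
  move=> x0; have -> : th1 = (fun x => (L - 1) + - ln x) by apply/funext => t; rewrite /th1; ring.
  exact: (is_derive_cstD_fun _ (L - 1) _ _ _ (is_deriveN_fun _ _ _ _ (is_derive1_ln x0))).
have slope_gt0 y : dot y y <= s2 -> 0 < dot y e -> 0 < slope kap e y.
  by move=> ys ye; rewrite divr_gt0 // height_gt0_ball.
have L_gt y : dot y y <= s2 -> 0 < dot y e ->
   ((1 - m) * (1 - kap * s2))^-1 < L - ln (slope kap e y).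
  move=> ys ye; have [sZ _] := hZ y ys; have s0 := slope_gt0 y ys ye.
  have := ln_sublinear s0.
  by rewrite /L; lra.
have I0 : 0 < ((1 - m) * (1 - kap * s2))^-1 by rewrite invr_gt0 mulr_gt0 // subr_gt0.
have barrierE y : dot y y <= s2 ->
   barrier kap e th y = dot y e * (L - ln (slope kap e y)).
  move=> ys; rewrite /barrier /th mulrA; congr (_ * _).
  by rewrite /slope mulrC divfK // gt_eqF // height_gt0_ball.
have barrier_gt0 y : dot y y <= s2 -> 0 < dot y e -> 0 < barrier kap e th y.
  by move=> ys ye; rewrite barrierE // mulr_gt0 //; apply: lt_trans (L_gt y ys ye).
set M0 := w y0 / barrier kap e th y0.
have M00 : 0 < M0 by rewrite divr_gt0 // barrier_gt0.
(* As the height is at least [c], [dot y e <= delta] gives [z <= expR (L - X)], that is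
   [L - ln z >= X]; the linear bound on [w] then falls below [M0] times the barrier. *)
pose X := C / (dot e e * M0) + 1; pose delta := c * expR (L - X).
have delta0 : 0 < delta by rewrite mulr_gt0 // expR_gt0.
have small y : dot y y <= s2 -> 0 < dot y e -> dot y e <= delta ->
    w y < M0 * barrier kap e th y.
  move=> ys ye yd; apply: le_lt_trans (w_le y ys ye) _.
  have XL : X <= L - ln (slope kap e y).
    suff : ln (slope kap e y) <= L - X by lra.
    rewrite -[L - X]expRK ler_ln ?posrE ?expR_gt0 //; last exact: slope_gt0.
    rewrite ler_pdivrMr ?height_gt0_ball // mulrC.
    by apply: le_trans yd _; rewrite ler_pM2r ?expR_gt0 ?hc.
  have : C / (dot e e * M0) < L - ln (slope kap e y) by rewrite /X in XL; lra.
  have eM0 : 0 < dot e e * M0 by exact: mulr_gt0.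
  rewrite barrierE // ltr_pdivrMr // => h.
  have -> : C * (dot y e / dot e e) = dot y e * (C / dot e e) by ring.
  rewrite [ltRHS]mulrCA ltr_pM2l // ltr_pdivrMr //; lra.
(* The barrier is positive on [K]. On the face [dot y e = delta] the quotient is less than [M0], its
   value at [y0], so the maximum over [K] is attained off that face. *)
pose K : set 'rV[R]_k := [set y | dot y y <= s2] `&` [set y | delta <= dot y e].
have cK : compact K.
  apply: compact_closedI; first exact: compact_dot_ball.
  apply: (@closed_comp _ _ (fun y : 'rV[R]_k => dot y e) [set x | delta <= x]) => //.
    by move=> y _; exact/differentiable_continuous/differentiable_dotl.
have Ke y : K y -> 0 < dot y e by move=> [_ /=]; apply: lt_le_trans.
have Ky0 : K y0.
  split=> //=; rewrite leNgt; apply/negP => /ltW yd.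
  have := small y0 y0s y0e yd; rewrite divfK ?ltxx // gt_eqF //.
  exact: barrier_gt0.
have [|||p [M [Kp wp leM le_w]]] := exists_max_ratio K w (barrier kap e th) y0 cK Ky0.
- by move=> y [ys _]; have [] := d y ys.
- move=> y Ky; have [ys _] := Ky; apply: continuous_barrier (dth _ _).
    exact: height_gt0_ball.
  by apply: slope_gt0 => //; exact: Ke.
- by move=> y Ky; apply: barrier_gt0 (Ke y Ky); case: Ky.
have M_gt0 : 0 < M by apply: lt_le_trans leM.
have [ps _] := Kp; have pe := Ke p Kp; rewrite /= in ps.
have ped : delta < dot p e.
  rewrite ltNge; apply/negP => /(small p ps pe); rewrite wp.
  by rewrite ltr_pM2r ?barrier_gt0 // ltNge leM.
have sp0 := slope_gt0 p ps pe.
have [psE|ps'] := eqVneq (dot p p) s2; last first.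
  have {}ps : dot p p < s2 by rewrite lt_neqAle ps' ps.
  apply: (equation_contact e th th1 w [set y | delta < dot y e] p M _ e0 M_gt0 eqw ps
    (near_dot_gt p e delta ped) _ _ (dth1 _ sp0) _ wp).
  - by move=> y /= yd ys; apply: dth; apply: slope_gt0 => //; apply: lt_trans yd.
  - by move=> y /= /ltW yd ys; apply: le_w.
  - by rewrite oppr_lt0 invr_gt0.
have h0 := height_gt0_ball p ps.
(* This width keeps [t *: p] in [K]: [t > delta / dot p e] means [dot (t *: p) e > delta]. *)
apply: (no_boundary_contact kap e th th1 w p M m (1 - delta / dot p e) M_gt0 h0
  (dth _ sp0) (rw p psE) wp).
- by rewrite subr_gt0 ltr_pdivrMr // mul1r.
- move=> t t1 t2.
  have t3 : delta < t * dot p e by rewrite -ltr_pdivrMr //; lra.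
  have t4 : 0 < t by rewrite -(pmulr_lgt0 _ pe); apply: lt_trans t3.
  apply: le_w; split=> /=; last by rewrite dotZl; exact: ltW.
  have tt1 : t * t <= 1 by nra.
  by rewrite dotZl dotZr psE mulrA ler_piMl // ltW.
have hsq := height_sqr _ _ h0; rewrite psE in hsq.
rewrite barrierE // /dbarrier /th1 /th psE.
set z := slope kap e p in sp0 *; set h := height kap p in h0 hsq *.
have -> : dot p e = z * h by rewrite /z /slope -/h divfK // gt_eqF.
have := L_gt p ps pe; rewrite -/z -hsq; set l := L - ln z.
rewrite -[X in X < _]div1r ltr_pdivrMr; last by rewrite mulr_gt0 ?exprn_gt0 ?subr_gt0.
move=> hl; rewrite -subr_gt0.
have -> : (l - 1) * (z * h) + (z * l - z * (l - 1)) * (- kap * s2 / h) - m * (z * h * l)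
   = z / h * (l * ((1 - m) * h ^+ 2) - 1).
  have -> : - kap * s2 = h ^+ 2 - 1 by rewrite hsq; ring.
  by field; rewrite gt_eqF.
by rewrite mulr_gt0 ?divr_gt0 // subr_gt0.
Qed.

Theorem equation_radial_solution m f : (0 < k)%N -> m < 1 -> equation f -> radial m f ->
  exists c, forall y, dot y y <= s2 -> f y = c * height kap y.
Proof.
move=> k0 m1 eqf rf.
(* The reflection along [e = p - q] sends [p] to [q], and [2 <p, e> = |e|^2 > 0] places [p] in the
   half ball where [w <= 0]. *)
have le_f p q : dot p p <= s2 -> dot p p = dot q q -> f p <= f q.
  move=> ps pq; have [->//|] := eqVneq p q; rewrite -subr_eq0; set e := p - q => e0.
  have ee := dot_gt0 e e0.
  pose S : 'M[R]_k := 1%:M - (2 / dot e e) *: (e^T *m e).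
  have yS y : y *m S = y - (2 * dot y e / dot e e) *: e.
    rewrite mulmxBr mulmx1 -scalemxAr mulmxA [y *m e^T]mx11_scalar -/(dot y e).
    by rewrite mul_scalar_mx scalerA mulrAC.
  have ST : S^T = S by rewrite linearB /= linearZ /= trmx_mul trmxK trmx1.
  have SS : S *m S = 1%:M.
    apply/row_matrixP => i; rewrite -[X in row i (X *m S)](mul1mx S) !row_mul.
    move: (row i _) => y; rewrite !yS dotDl dotNl dotZl divfK; last by rewrite gt_eqF.
    rewrite -addrA -opprD -scalerDl.
    have -> : 2 * dot y e / dot e e + 2 * (dot y e - 2 * dot y e) / dot e e = 0 by ring.
    by rewrite scale0r subr0.
  have eE : dot e e = 2 * dot p e.
    rewrite /e !(dotDl, dotDr, dotNl, dotNr) (dotC q p) pq; ring.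
  have pS : p *m S = q.
    rewrite yS -eE divff ?gt_eqF // scale1r /e opprB addrC subrK //.
  pose w y := 1 * f y + -1 * f (y *m S).
  have eqw : equation w.
    by apply: chart_equation_lincomb => //; exact: chart_equation_mulmx.
  have rw : radial m w.
    by apply: radial_condition_lincomb => //; exact: radial_condition_mulmx.
  have := equation_half_ball_le0 m e w m1 e0 eqw rw.
  have : w p <= 0.
    apply: (equation_half_ball_le0 m e w m1 e0 eqw rw _ p ps); last lra.
    by move=> y _ ye; rewrite /w yS ye mulr0 mul0r scale0r subr0; ring.
  by rewrite /w pS; lra.
pose i0 := Ordinal k0.
pose b : 'rV[R]_k := Num.sqrt s2 *: delta_mx 0 i0.
have bs : dot b b = s2.
  by rewrite /b dotZl dotZr dot_delta mxE !eqxx mulr1 -expr2 sqr_sqrtr // ltW.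
have e0 : (delta_mx 0 i0 : 'rV[R]_k) != 0.
  by apply/eqP => /rowP/(_ i0)/eqP; rewrite !mxE !eqxx oner_eq0.
have hb y : dot y y = s2 -> height kap y = height kap b by rewrite /height bs => ->.
have fb y : dot y y = s2 -> f y = f b.
  by move=> ys; apply/eqP; rewrite eq_le !le_f ?ys ?bs.
have hb0 : 0 < height kap b by apply: height_gt0_ball; rewrite bs.
(* This [c] matches the constant boundary values, so the Dirichlet comparison applies to
   [f - c * height] and to its negative. *)
pose c := f b / height kap b; exists c => y ys.
have eqh : equation (height kap : 'rV[R]_k -> R) := chart_equation_height kap s2 kap2 ks2.
have h1 := equation_dirichlet_le0 _ _ e0
  (chart_equation_lincomb kap s2 1 (- c) _ _ eqf eqh) _ y ys.
have h2 := equation_dirichlet_le0 _ _ e0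
  (chart_equation_lincomb kap s2 (-1) c _ _ eqf eqh) _ y ys.
suff [] : (1 * f y + - c * height kap y <= 0) /\ (-1 * f y + c * height kap y <= 0) by lra.
by split; [apply: h1|apply: h2] => z zs; rewrite (hb z zs) (fb z zs) /c;
  field; rewrite gt_eqF.
Qed.

End Comparison.

(** * Orthonormal frames *)

Section Frames.
Context {R : realType} {n : nat} (P : {vspace 'rV[R]_n.+1}).
Hypothesis poleP : pole R n \in P.

Lemma dot_pole (v : 'rV[R]_n.+1) : dot v (pole R n) = v 0 0.
Proof. exact: dot_delta. Qed.

Lemma orthonormal_rows_bound m (B : 'M[R]_(m, n.+1)) :
  (forall i, row i B \in P) -> B *m B^T = 1%:M -> (m <= \dim P)%N.
Proof.
move=> BP BB; pose X := [tuple row i B | i < m].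
have freeX : free X.
  apply/freeP => c c0 i.
  have /(congr1 (fun A => (A *m B^T) 0 i)) : (\row_j c j) *m B = 0.
    rewrite mulmx_sum_row -[RHS]c0; apply: eq_bigr => j _.
    by rewrite mxE -tnth_nth tnth_mktuple.
  by rewrite -mulmxA BB mulmx1 mul0mx !mxE.
have : (<<X>> <= P)%VS by apply/span_subvP => _ /tnthP[i ->]; rewrite tnth_mktuple.
by move=> /dimvS; rewrite (eqP freeX) size_tuple.
Qed.

Lemma orthonormal_rows_complement m (B : 'M[R]_(m, n.+1)) :
  (m < \dim P)%N -> exists2 v, v \in P & v - v *m B^T *m B != 0.
Proof.
move=> mP; apply: contrapT => H; move: mP; apply/negP; rewrite -leqNgt.
pose X := [tuple row i B | i < m].
suff /dimvS/leq_trans : (P <= <<X>>)%VS.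
  by apply; rewrite (leq_trans (dim_span X)) // size_tuple.
apply/subvP => v vP; have [/eqP|v0] := eqVneq (v - v *m B^T *m B) 0; last by case: H; exists v.
rewrite subr_eq0 => /eqP ->; rewrite mulmx_sum_row; apply: memv_suml => i _.
by apply/memvZ/memv_span/tnthP; exists i; rewrite tnth_mktuple.
Qed.

Lemma mul_frame_pole j (Q : 'M[R]_(j, n.+1)) : orthonormal_frame P Q -> Q *m (pole R n)^T = 0.
Proof.
move=> [_ Q0 _]; apply/matrixP => i l; rewrite (ord1 l) mxE (bigD1 0) //= big1 => [|a a0].
  by rewrite Q0 mul0r addr0 mxE.
by rewrite !mxE (negPf a0) andbF mulr0.
Qed.

Lemma augmented_frame j (Q : 'M[R]_(j, n.+1)) : orthonormal_frame P Q ->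
  let B := col_mx (pole R n) Q in (forall i, row i B \in P) /\ B *m B^T = 1%:M.
Proof.
move=> fQ B; have [QP Q0 QQ] := fQ; split.
  move=> i; case: (split_ordP i) => l ->.
    by rewrite rowKu (ord1 l) row_id.
  by rewrite rowKd.
rewrite tr_col_mx mul_col_row QQ (mul_frame_pole _ Q fQ).
have -> : pole R n *m Q^T = 0.
  by apply: trmx_inj; rewrite trmx_mul trmxK trmx0 mul_frame_pole.
have -> : pole R n *m (pole R n)^T = 1%:M.
  by apply/rowP => i; rewrite (ord1 i) -/(dot _ _) dot_pole !mxE.
by rewrite -scalar_mx_block.
Qed.

Lemma partial_frame_proj j (Q : 'M[R]_(j, n.+1)) (v : 'rV[R]_n.+1) : orthonormal_frame P Q ->
  v *m (col_mx (pole R n) Q)^T *m col_mx (pole R n) Q =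
  v 0 0 *: pole R n + v *m Q^T *m Q.
Proof.
move=> fQ; rewrite tr_col_mx -mulmxA mul_row_col mulmxDr !mulmxA.
congr (_ + _); rewrite [v *m _]mx11_scalar -/(dot _ _) dot_pole.
by rewrite mul_scalar_mx.
Qed.

(** One Gram-Schmidt step: the remainder of [v] after projection to the pole and the rows of [Q] is
    normalised and appended. *)
Lemma partial_frame_extend j (Q : 'M[R]_(j, n.+1)) v : orthonormal_frame P Q ->
  v \in P -> v - v *m (col_mx (pole R n) Q)^T *m col_mx (pole R n) Q != 0 ->
  exists Q' : 'M[R]_(j + 1, n.+1), orthonormal_frame P Q'.
Proof.
move=> fQ vP; have [QP Q0 QQ] := fQ.
rewrite partial_frame_proj //; set w := v - _ => w0.
have wP : w \in P.
  rewrite memvB // memvD ?memvZ // mulmx_sum_row memv_suml // => i _.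
  by rewrite memvZ.
have w00 : w 0 0 = 0.
  rewrite -dot_pole dotDl dotNl dotDl dotZl !dot_pole mxE !eqxx mulr1 opprD addrA subrr.
  rewrite add0r -dot_pole /dot -mulmxA mul_frame_pole // mulmx0 mxE oppr0 //.
have Qw : Q *m w^T = 0.
  apply: trmx_inj; rewrite trmx_mul trmxK trmx0 mulmxBl mulmxDl -(mulmxA (v *m Q^T)) QQ mulmx1.
  rewrite -scalemxAl; have -> : pole R n *m Q^T = 0.
    by apply: trmx_inj; rewrite trmx_mul trmxK trmx0 mul_frame_pole.
  by rewrite scaler0 add0r subrr.
have ww := dot_gt0 w w0.
pose c := (Num.sqrt (dot w w))^-1; exists (col_mx Q (c *: w)); split.
- move=> i; case: (split_ordP i) => l ->.
    by rewrite rowKu.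
  by rewrite rowKd (ord1 l) row_id memvZ.
- move=> i; case: (split_ordP i) => l ->.
    by rewrite col_mxEu.
  by rewrite col_mxEd (ord1 l) mxE w00 mulr0.
- rewrite tr_col_mx mul_col_row QQ linearZ /= -scalemxAr Qw scaler0.
  have -> : c *: w *m Q^T = 0.
    by apply: trmx_inj; rewrite trmx_mul trmxK trmx0 linearZ /= -scalemxAr Qw scaler0.
  have -> : c *: w *m (c *: w^T) = 1%:M.
    rewrite -scalemxAl -scalemxAr scalerA [w *m w^T]mx11_scalar -/(dot w w) scale_scalar_mx.
    by rewrite -expr2 /c exprVn sqr_sqrtr ?ltW // mulVf // gt_eqF.
  by rewrite -scalar_mx_block.
Qed.

Lemma orthonormal_frame_exists k : \dim P = k.+1 ->
  exists Q : 'M[R]_(k, n.+1), orthonormal_frame P Q.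
Proof.
move=> dimP; suff H j : (j <= k)%N -> exists Q : 'M[R]_(j, n.+1), orthonormal_frame P Q.
  exact: H.
elim: j => [_|j IH jk]; first by exists 0; split=> [[]|[]|] //; apply/matrixP => -[].
have [Q fQ] := IH (ltnW jk).
have [|v vP v0] := orthonormal_rows_complement _ (col_mx (pole R n) Q).
  by rewrite dimP ltnS.
have [Q' fQ'] := partial_frame_extend j Q v fQ vP v0.
by move: Q' fQ'; rewrite addn1 => Q' fQ'; exists Q'.
Qed.

(** A nonzero remainder would extend the pole and [Q] to [k + 2] orthonormal vectors in a space of
    dimension [k + 1]. *)
Lemma orthonormal_frame_complete k (Q : 'M[R]_(k, n.+1)) v :
  \dim P = k.+1 -> orthonormal_frame P Q -> v \in P ->
  v = v 0 0 *: pole R n + v *m Q^T *m Q.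
Proof.
move=> dimP fQ vP; rewrite -partial_frame_proj //; apply/eqP; rewrite -subr_eq0.
apply/negPn/negP => v0; have [Q' fQ'] := partial_frame_extend k Q v fQ vP v0.
have [BP BB] := augmented_frame _ Q' fQ'.
by have := orthonormal_rows_bound _ _ BP BB; rewrite dimP addn1 add1n ltnn.
Qed.

End Frames.

(** * The induced metric *)

Section Gradient.
Context {R : realType}.

Lemma is_derive_mx {V : normedModType R} {m n : nat} (F : V -> 'M[R]_(m, n)) y v
  (D : 'M[R]_(m, n)) :
  (forall i j, is_derive y v (fun z => F z i j) (D i j)) -> is_derive y v F D.
Proof.
move=> h; have dF : derivable F y v by apply/derivable_mxP => i j; case: (h i j).
split=> //; rewrite derive_mx //; apply/matrixP => i j; rewrite mxE.
by case: (h i j).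
Qed.

Definition gradient {d} (u : 'rV[R]_d -> R) (x : 'rV[R]_d) : 'rV[R]_d :=
  \row_i partial i u x.

Lemma is_derive_gradient {d} (u : 'rV[R]_d -> R) x v : differentiable u x ->
  is_derive x v u (dot (gradient u x) v).
Proof.
move=> du; split; first exact: diff_derivable.
rewrite deriveE // {1}(row_sum_delta v) linear_sum dotE; apply: eq_bigr => i _.
by rewrite linearZ /= mxE /partial deriveE // mulrC.
Qed.

End Gradient.

(** The matrix determinant lemma, read off two block-triangular factorisations of one matrix. *)
Lemma det_add_outer {F : comPzRingType} {k : nat} (u v : 'rV[F]_k) :
  \det (1%:M + u^T *m v) = 1 + (v *m u^T) 0 0.
Proof.
pose B := block_mx (1%:M : 'M[F]_k) (- u^T) v (1%:M : 'M[F]_1).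
have E1 : B = block_mx 1%:M 0 v 1%:M *m block_mx 1%:M (- u^T) 0 (1%:M + v *m u^T).
  rewrite mulmx_block !(mul1mx, mulmx1, mul0mx, mulmx0, addr0) mulmxN.
  by rewrite addrCA addNr addr0.
have E2 : B = block_mx (1%:M + u^T *m v) (- u^T) 0 1%:M *m block_mx 1%:M 0 v 1%:M.
  by rewrite mulmx_block !(mul1mx, mulmx1, mul0mx, mulmx0, add0r) mulNmx addrK.
have : \det B = \det B by [].
rewrite {1}E1 E2 !det_mulmx !det_lblock !det_ublock !det1 !mul1r !mulr1 => <-.
by rewrite det_mx11 !mxE eqxx.
Qed.

Section Chart.
Context {R : realType} {n k : nat} (M : geometry) (Q : 'M[R]_(k, n.+1)).
Hypothesis Q0 : forall i, Q i 0 = 0.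
Hypothesis QQ : Q *m Q^T = 1%:M.
Implicit Types (y a b : 'rV[R]_k) (u : 'rV[R]_n.+1 -> R) (f : 'rV[R]_k -> R).

Local Notation kap := (curvature R M).
Local Notation phi := (graph_param M Q).
Local Notation g := (induced_metric M Q).

Lemma curvature2 : kap ^+ 2 = 1.
Proof. by case: M => /=; rewrite ?sqrrN expr1n. Qed.

Lemma graph_paramE y : phi y = height kap y *: pole R n + y *m Q.
Proof. by []. Qed.

Lemma mulmx_frame0 y : (y *m Q) 0 0 = 0.
Proof. by rewrite mxE big1 // => i _; rewrite Q0 mulr0. Qed.

Lemma graph_param0 y : phi y 0 0 = height kap y.
Proof. by rewrite graph_paramE mxE mulmx_frame0 !mxE !eqxx mulr1 addr0. Qed.

Lemma form_frame (c d : R) y z :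
  Defs.form M (c *: pole R n + y *m Q) (d *: pole R n + z *m Q) = kap * (c * d) + dot y z.
Proof.
have E (c' : R) y' : (c' *: pole R n + y' *m Q) 0 0 = c'.
  by rewrite mxE mulmx_frame0 !mxE !eqxx mulr1 addr0.
have E' (c' : R) y' i : (c' *: pole R n + y' *m Q) 0 (lift ord0 i) = (y' *m Q) 0 (lift ord0 i).
  by rewrite mxE !mxE mulr0 add0r.
rewrite /Defs.form !E; congr (_ + _); under eq_bigr do rewrite !E'.
have -> : dot y z = dot (y *m Q) (z *m Q).
  by rewrite /dot trmx_mul mulmxA -(mulmxA y) QQ mulmx1.
by rewrite dotE big_ord_recl !mulmx_frame0 mul0r add0r.
Qed.

Definition chart_jacobian y : 'M[R]_(k, n.+1) :=
  (- kap / height kap y) *: (y^T *m pole R n) + Q.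

Lemma mul_jacobian y a : a *m chart_jacobian y =
  (- kap * dot y a / height kap y) *: pole R n + a *m Q.
Proof.
rewrite mulmxDr -scalemxAr mulmxA [a *m y^T]mx11_scalar -/(dot a y) mul_scalar_mx scalerA.
by congr (_ *: _ + _); rewrite dotC; ring.
Qed.

Lemma is_derive_graph_param y a : 0 < height kap y ->
  is_derive y a phi (a *m chart_jacobian y).
Proof.
move=> h0; apply: is_derive_mx => i j; rewrite (ord1 i) mul_jacobian.
have colE (c : R) z : (c *: pole R n + z *m Q) 0 j = c * pole R n 0 j + dot z (col j Q)^T.
  rewrite mxE mxE /dot trmxK; congr (_ + _).
  by rewrite !mxE; apply: eq_bigr => l _; rewrite mxE.
have -> : (fun z => phi z 0 j) = (fun z => height kap z * pole R n 0 j + dot z (col j Q)^T).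
  by apply/funext => z; rewrite graph_paramE colE.
rewrite colE.
exact: (is_deriveD_fun _ _ _ _ _ _ (is_deriveZr_fun _ (pole R n 0 j) _ _ _
  (is_derive_height kap y a h0)) (is_derive_dot y a _)).
Qed.

Lemma differentiable_graph_param y : 0 < height kap y -> differentiable phi y.
Proof.
move=> h0; apply: differentiableD; last exact: differentiable_mulmx.
by apply: differentiableZl; exact: differentiable_height.
Qed.

Lemma induced_metricE y : 0 < height kap y ->
  g y = 1%:M + (kap / height kap y ^+ 2) *: (y^T *m y).
Proof.
move=> h0; apply/matrixP => i j; rewrite mxE.
have E l : partial l phi y = (- kap * y 0 l / height kap y) *: pole R n + delta_mx 0 l *m Q.
  rewrite -dot_delta -mul_jacobian /partial.
  by have [_] := is_derive_graph_param y (delta_mx 0 l) h0.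
rewrite !E form_frame dot_delta !mxE big_ord1 !mxE eqxx /= addrC (eq_sym j i).
congr (_ + _); have -> : kap / height kap y ^+ 2 = kap * kap ^+ 2 / height kap y ^+ 2.
  by rewrite curvature2 mulr1.
by field; rewrite gt_eqF.
Qed.

Lemma sqrt_det_induced_metric y : 0 < height kap y ->
  Num.sqrt (\det (g y)) = (height kap y)^-1.
Proof.
move=> h0; rewrite induced_metricE // scalemxAr det_add_outer.
have -> : 1 + ((kap / height kap y ^+ 2) *: y *m y^T) 0 0 = (height kap y)^-1 ^+ 2.
  rewrite -scalemxAl mxE -/(dot y y).
  have -> : kap / height kap y ^+ 2 * dot y y = (1 - height kap y ^+ 2) / height kap y ^+ 2.
    by rewrite height_sqr //; ring.
  by field; rewrite gt_eqF.
by rewrite sqrtr_sqr ger0_norm // invr_ge0 ltW.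
Qed.

Lemma invmx_induced_metric y : 0 < height kap y ->
  invmx (g y) = 1%:M - kap *: (y^T *m y).
Proof.
move=> h0; have h0' : height kap y != 0 by rewrite gt_eqF.
suff gB : g y *m (1%:M - kap *: (y^T *m y)) = 1%:M.
  by have [gu _] := mulmx1_unit gB; rewrite -[RHS](mulKmx gu) gB mulmx1.
have WW : (y^T *m y) *m (y^T *m y) = dot y y *: (y^T *m y).
  rewrite mulmxA -(mulmxA _ y) [y *m y^T]mx11_scalar -/(dot y y).
  by rewrite mul_mx_scalar -scalemxAl.
rewrite induced_metricE // mulmxDl mul1mx mulmxBr mulmx1 -scalemxAl -scalemxAr WW.
rewrite !scalerA -scalerBl addrAC -addrA -scalerBl.
rewrite [X in X *: _](_ : _ = 0) ?scale0r ?addr0 //.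
have -> : kap / height kap y ^+ 2 * kap * dot y y =
   kap * (1 - height kap y ^+ 2) / height kap y ^+ 2.
  by rewrite (height_sqr kap y) //; ring.
by field.
Qed.

Lemma gradE f y : 0 < height kap y ->
  grad g f y = gradient f y - (kap * dot (gradient f y) y) *: y.
Proof.
move=> h0; rewrite /grad invmx_induced_metric // mulmxBr mulmx1 -scalemxAr mulmxA.
by rewrite [_ *m y^T]mx11_scalar -/(dot _ y) mul_scalar_mx scalerA.
Qed.

End Chart.

(** * Laplacian, conormal and regularity in the chart *)

Section ChartOperators.
Context {R : realType} {n k : nat} (M : geometry) (Q : 'M[R]_(k, n.+1)).
Hypothesis Q0 : forall i, Q i 0 = 0.
Hypothesis QQ : Q *m Q^T = 1%:M.
Implicit Types (y a b : 'rV[R]_k) (u : 'rV[R]_n.+1 -> R) (f : 'rV[R]_k -> R).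

Local Notation kap := (curvature R M).
Local Notation phi := (graph_param M Q).
Local Notation g := (induced_metric M Q).

Lemma near_height_gt0 y : 0 < height kap y -> \forall z \near y, 0 < height kap z.
Proof.
move=> h0; have c : {for y, continuous (height kap)}.
  exact/differentiable_continuous/differentiable_height.
by move/cvgr_gt: c; apply.
Qed.

(** The weight [1 / h] has gradient [kap y / h^3]; its contribution [kap <Df, y>] cancels the
    [- kap <Df, y>] that arises from differentiating [<Df z, z>], so exactly [k] copies remain. *)
Lemma laplacian_chartE f (Df : 'rV[R]_k -> 'rV[R]_k) (H : 'M[R]_k) y :
  0 < height kap y -> (\forall z \near y, gradient f z = Df z) ->
  (forall a b, is_derive y b (fun z => dot (Df z) a) (dot (b *m H) a)) ->
  laplacian g f y =
  - (\tr H - kap * dot (y *m H) y - kap * k%:R * dot (Df y) y).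
Proof.
move=> h0 nD dD; have h0' : height kap y != 0 by rewrite gt_eqF.
have S0 := sqrt_det_induced_metric M Q Q0 QQ y h0.
rewrite /laplacian.
rewrite /divergence.
rewrite {1}S0.
rewrite invrK.
congr (- _).
pose X i z := (height kap z)^-1 * (dot (Df z) (delta_mx 0 i) +
  - (kap * (dot (Df z) z * dot z (delta_mx 0 i)))).
have E i : partial i (fun z => (Num.sqrt (\det (g z)) * grad g f z 0 i : R)) y =
    partial i (X i) y.
  apply: near_eq_derive; near=> z.
  have hz : 0 < height kap z by near: z; exact: near_height_gt0.
  have Dz : gradient f z = Df z by near: z.
  by rewrite (sqrt_det_induced_metric M Q Q0 QQ z hz) (gradE M Q Q0 QQ f z hz) Dz /X !dot_delta mulrA !mxE.
under eq_bigr do rewrite E.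
have dDz b : is_derive y b (fun z => dot (Df z) z) (dot (b *m H) y + dot (Df y) b).
  have -> : (fun z => dot (Df z) z) = (fun z => \sum_j dot (Df z) (delta_mx 0 j) * dot z (delta_mx 0 j)).
    by apply/funext => z; rewrite dotE; under [RHS]eq_bigr do rewrite !dot_delta.
  apply: (is_derive_eq_real _ _ _ _ _ (is_derive_sum_fun _ _ _ _ _ (fun j =>
    is_deriveM_fun _ _ _ _ _ _ (dD (delta_mx 0 j) b) (is_derive_dot y b (delta_mx 0 j))))).
  rewrite big_split /= addrC !dotE; congr (_ + _).
    by apply: eq_bigr => j _; rewrite !dot_delta mulrC.
  by apply: eq_bigr => j _; rewrite !dot_delta.
set D := dot (Df y) y.
have dX i : partial i (X i) y = (height kap y)^-1 *
    (H i i - kap * (dot (delta_mx 0 i *m H) y * y 0 i) - kap * (Df y 0 i * y 0 i) - kap * D)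
    + kap / height kap y ^+ 3 * (Df y 0 i * y 0 i - kap * D * y 0 i ^+ 2).
  have d1 := is_deriveV_fun _ _ _ _ h0' (is_derive_height kap y (delta_mx 0 i) h0).
  have d2 := is_deriveZ_fun _ kap _ _ _ (is_deriveM_fun _ _ _ _ _ _ (dDz (delta_mx 0 i))
      (is_derive_dot y (delta_mx 0 i) (delta_mx 0 i))).
  have [_] := is_deriveM_fun _ _ _ _ _ _ d1 (is_deriveD_fun _ _ _ _ _ _
     (dD (delta_mx 0 i) (delta_mx 0 i)) (is_deriveN_fun _ _ _ _ d2)).
  rewrite /partial => ->.
  rewrite !dot_delta -rowE !mxE !eqxx -/D /=; field.
  exact: h0'.
under eq_bigr do rewrite dX.
rewrite big_split /= -!mulr_sumr !sumrB -!mulr_sumr.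
have -> : \sum_i Df y 0 i * y 0 i = D by rewrite /D dotE.
have -> : \sum_i dot (delta_mx 0 i *m H) y * y 0 i = dot (y *m H) y.
  have -> : dot (y *m H) y = dot y (y *m H^T) by rewrite /dot trmx_mul trmxK mulmxA.
  rewrite [RHS]dotE; apply: eq_bigr => i _; rewrite -rowE mulrC dotE mxE; congr (_ * _).
  by apply: eq_bigr => j _; rewrite !mxE mulrC.
have -> : \sum_(i < k) H i i = \tr H by [].
have -> : \sum_i y 0 i ^+ 2 = dot y y by rewrite dotE.
rewrite sumr_const card_ord.
have -> : kap / height kap y ^+ 3 * (D - kap * D * dot y y) = kap / height kap y * D.
  have -> : kap * D * dot y y = D * (1 - height kap y ^+ 2).
    by rewrite (height_sqr kap y h0); ring.
  by field.
rewrite -[_ *+ k]mulr_natr; field.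
exact: h0'.
Unshelve. all: by end_near. Qed.

(** Normalisation erases [F] except for the sign of its derivative: [kap * d < 0] says that the
    distance grows with [|y|]. The radial vector [y] has metric length [|y| / h]. *)
Lemma conormal_chartE (F : R -> R) (d : R) y : 0 < height kap y -> 0 < dot y y ->
  (forall x, dist_pole M (phi x) = F (height kap x)) ->
  is_derive (height kap y) 1 F d -> kap * d < 0 ->
  conormal g (fun x => dist_pole M (phi x)) y =
    (height kap y / Num.sqrt (dot y y)) *: y.
Proof.
move=> h0 y0 FE dF kd; have h0' : height kap y != 0 by rewrite gt_eqF.
pose c := - (kap * d) / height kap y.
have c0 : 0 < c by rewrite divr_gt0 // oppr_gt0.
have -> : (fun x => dist_pole M (phi x)) = (fun x => F (height kap x)) by apply/funext.
have gF : gradient (fun x => F (height kap x)) y = c *: y.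
  apply/rowP => i; rewrite !mxE /partial.
  have [_ ->] := is_derive1_comp_fun _ _ _ _ _ _ dF (is_derive_height kap y (delta_mx 0 i) h0).
  by rewrite dot_delta /c; ring.
have gE : grad g (fun x => F (height kap x)) y = (c * height kap y ^+ 2) *: y.
  rewrite (gradE M Q Q0 QQ _ y h0) gF dotZl -scalerBl; congr (_ *: _).
  by rewrite (height_sqr kap y h0); ring.
have mE v w : metric g y v w = dot v w + kap / height kap y ^+ 2 * (dot v y * dot y w).
  rewrite /metric (induced_metricE M Q Q0 QQ y h0) mulmxDr mulmx1 -scalemxAr -/(dot _ w).
  by rewrite dotDl dotZl dot_outer.
rewrite /conormal gE mE !(dotZl, dotZr) scalerA; congr (_ *: _).
set h := height kap y in h0 h0' *; set q := Num.sqrt (dot y y).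
have q0 : 0 < q by rewrite sqrtr_gt0.
have -> : c * h ^+ 2 * (c * h ^+ 2 * dot y y) + kap / h ^+ 2 *
  (c * h ^+ 2 * dot y y * (c * h ^+ 2 * dot y y)) = (c * h * q) ^+ 2.
  have -> : c * h ^+ 2 * (c * h ^+ 2 * dot y y) + kap / h ^+ 2 *
    (c * h ^+ 2 * dot y y * (c * h ^+ 2 * dot y y)) =
     c ^+ 2 * h ^+ 2 * (dot y y) * (h ^+ 2 + kap * dot y y) by field.
  have -> : h ^+ 2 + kap * dot y y = 1 by rewrite (height_sqr kap y h0) subrK.
  have qq : q ^+ 2 = dot y y by rewrite sqr_sqrtr // ltW.
  by rewrite mulr1 !exprMn qq.
rewrite sqrtr_sqr ger0_norm; last by rewrite ltW //; apply: mulr_gt0 => //; apply: mulr_gt0.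
by field; rewrite h0' !gt_eqF.
Qed.

Lemma C2_data_graph_param s2 (U : set 'rV[R]_n.+1) u : smooth_on U u ->
  (forall y, dot y y <= s2 -> 0 < height kap y /\ U (phi y)) ->
  exists Df Hf, C2_data s2 (fun y => u (phi y)) Df Hf.
Proof.
move=> su inU.
pose Df y := gradient u (phi y) *m (chart_jacobian M Q y)^T.
pose Hf y := \matrix_(i, j) partial i (fun z => Df z 0 j) y.
exists Df, Hf => y ys; have [h0 Uy] := inU y ys.
have dphi := differentiable_graph_param M Q y h0.
have du : differentiable u (phi y) := su [::] (phi y) Uy.
have df : differentiable (fun y => u (phi y)) y by exact: differentiable_comp dphi du.
have dDf j : differentiable (fun z => Df z 0 j) y.
  have -> : (fun z => Df z 0 j) = (fun z => \sum_l partial l u (phi z) *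
     (- kap * (height kap z)^-1 * (z 0 j * pole R n 0 l) + Q j l)).
    apply/funext => z; rewrite mxE; apply: eq_bigr => l _; rewrite !mxE; congr (_ * (_ + _)).
    by rewrite big_ord1 !mxE.
  apply: differentiable_sum_fun => l; apply: differentiableM.
    by apply: (@differentiable_comp _ _ _ _ phi) => //; exact: (su [:: l] (phi y) Uy).
  apply: differentiableD => //; apply: differentiableM.
    apply: differentiableM => //; apply: differentiableV; last by rewrite gt_eqF.
    exact: differentiable_height.
  apply: differentiableM => //; exact: differentiable_coord.
have dDfa a : differentiable (fun z => dot (Df z) a) y.
  have -> : (fun z => dot (Df z) a) = (fun z => \sum_j Df z 0 j * a 0 j).
    by apply/funext => z; rewrite dotE.
  by apply: differentiable_sum_fun => j; apply: differentiableM.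
split.
- exact: differentiable_continuous.
- move=> a; split; first exact: diff_derivable.
  rewrite deriveE // (@diff_comp _ _ _ _ phi u) //=.
  have [_] := is_derive_graph_param M Q y a h0; rewrite deriveE // => dphiE.
  have [_] := is_derive_gradient u (phi y) ('d phi y a) du.
  rewrite deriveE // => ->.
  by rewrite dphiE /dot /Df trmx_mul mulmxA.
- by move=> a; exact/differentiable_continuous.
- move=> a b.
  have -> : (fun z => dot (Df z) a) = (fun z => \sum_j Df z 0 j * a 0 j).
    by apply/funext => z; rewrite dotE.
  apply: (is_derive_eq_real _ _ _ _ _ (is_derive_sum_fun _ _ _ _ _ (fun j =>
    is_deriveZr_fun _ (a 0 j) _ _ _ (is_derive_gradient _ y b (dDf j))))).
  rewrite dotE; apply: eq_bigr => j _; congr (_ * _).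
  by rewrite dotE [RHS]mxE; apply: eq_bigr => i _; rewrite !mxE mulrC.
Qed.

End ChartOperators.

(** * Boundary spheres *)

Definition dist_profile {R : realType} (M : geometry) (x : R) : R :=
  match M with
  | Spherical => acos x
  | Hyperbolic => ln (x + Num.sqrt (x ^+ 2 - 1))
  end.

Lemma dist_poleE {R : realType} {n : nat} M (x : 'rV[R]_n.+1) :
  dist_pole M x = dist_profile M (x 0 0).
Proof. by case: M. Qed.

(* [h] and [s2] are the height and the squared chart radius of the sphere of
   geodesic radius [r]. *)
Definition boundary_data {R : realType} (M : geometry) (r h s2 : R) : Prop :=
  [/\ 0 < h, 0 < s2, h ^+ 2 = 1 - curvature R M * s2,
      index_threshold M r = h / Num.sqrt s2 &
   [/\ exists2 d, is_derive h 1 (dist_profile M) d & curvature R M * d < 0,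
       forall x t, 0 < x -> 0 <= t -> x ^+ 2 = 1 - curvature R M * t ->
         (dist_profile M x < r) = (t < s2) &
       forall x t, 0 < x -> 0 <= t -> x ^+ 2 = 1 - curvature R M * t ->
         (dist_profile M x == r) = (t == s2)]].

Lemma spherical_boundary_data {R : realType} (r : R) : 0 < r < pi / 2 ->
  boundary_data Spherical r (cos r) (sin r ^+ 2).
Proof.
move=> /andP[r0 rpi]; have p0 := pi_gt0 R.
have c0 : 0 < cos r by apply: cos_gt0_pihalf; lra.
have s0 : 0 < sin r by apply: sin_gt0_pi; lra.
have cs := cos2Dsin2 r.
have c1 : cos r < 1 by nra.
have rI : r \in `[0, pi] by rewrite in_itv /=; apply/andP; split; lra.
have aI (x t : R) : 0 < x -> 0 <= t -> x ^+ 2 = 1 - 1 * t -> acos x \in `[0, pi] /\ cos (acos x) = x.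
  move=> x0 t0 xt; have x1 : -1 <= x <= 1 by apply/andP; split; nra.
  by have [] := acos_def x1; rewrite in_itv.
split=> //=.
- by rewrite exprn_gt0.
- lra.
- by rewrite sqrtr_sqr ger0_norm // ltW.
split.
- exists (- (Num.sqrt (1 - cos r ^+ 2))^-1).
    by apply: is_derive1_acos; lra.
  by rewrite mul1r oppr_lt0 invr_gt0 sqrtr_gt0; nra.
- move=> x t x0 t0 xt; have [xI xE] := aI x t x0 t0 xt.
  rewrite -(ltr_cos xI rI) xE -(ltr_pXn2r (n := 2)) ?nnegrE ?ltW //.
  by apply/idP/idP; lra.
- move=> x t x0 t0 xt; have [xI xE] := aI x t x0 t0 xt.
  apply/eqP/eqP => [xr|ts].
    by move: xE; rewrite xr => E; rewrite -E in xt; lra.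
  apply: cos_inj => //; rewrite xE; apply/eqP.
  by rewrite -(eqrXn2 (n := 2)) ?ltW //; apply/eqP; lra.
Qed.

(** The data are [cosh r] and [sinh r ^+ 2]. Distances are compared after exponentiation:
    [x + sqrt t] against [h + s = expR r], where [x] and [sqrt t] increase together because
    [x^2 - t = 1]. *)
Lemma hyperbolic_boundary_data {R : realType} (r : R) : 0 < r ->
  boundary_data Hyperbolic r ((expR r + expR (- r)) / 2) (((expR r - expR (- r)) / 2) ^+ 2).
Proof.
move=> r0; have E1 : 1 < expR r by rewrite expR_gt1.
have E0 := expR_gt0 r; have EN := expR_gt0 (- r).
have EE : expR r * expR (- r) = 1 by rewrite expRN divff // gt_eqF.
set h := (_ + _) / 2; set s := (_ - _) / 2.
have s0 : 0 < s by rewrite /s; nra.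
have h0 : 0 < h by rewrite /h; lra.
have hs : h ^+ 2 - 1 = s ^+ 2.
  have : h ^+ 2 - s ^+ 2 = expR r * expR (- r) by rewrite /h /s; field.
  by rewrite EE; lra.
have hsE : h + s = expR r by rewrite /h /s; lra.
have lnE (x t : R) : 0 < x -> 0 <= t -> x ^+ 2 = 1 - -1 * t ->
  0 < x + Num.sqrt (x ^+ 2 - 1) /\ Num.sqrt (x ^+ 2 - 1) ^+ 2 = t.
  move=> x0 t0 xt; have -> : x ^+ 2 - 1 = t by lra.
  by rewrite sqr_sqrtr // ltr_wpDr // sqrtr_ge0.
split=> //=.
- by rewrite exprn_gt0.
- lra.
- by rewrite sqrtr_sqr ger0_norm ?ltW // /h /s; field; rewrite ?gt_eqF //; nra.
split.
- have q0 : 0 < h ^+ 2 - 1 by rewrite hs exprn_gt0.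
  pose q := Num.sqrt (h ^+ 2 - 1); have qq : 0 < q by rewrite sqrtr_gt0.
  have dx : is_derive h 1 (fun x : R => x ^+ 2 - 1) (2 * h).
    by apply: is_derive_eq; rewrite /GRing.scale /=; ring.
  have dq := is_derive1_comp_fun (fun x : R => x ^+ 2 - 1) Num.sqrt _ _ _ _ (is_derive1_sqrt q0) dx.
  have dI := is_deriveD_fun _ _ _ _ _ _ (is_derive_id h 1) dq.
  have hq0 : 0 < h + q by exact: addr_gt0.
  have dln := is_derive1_comp_fun (fun x : R => x + Num.sqrt (x ^+ 2 - 1)) (@ln R) _ _ _ _
    (is_derive1_ln hq0) dI.
  exists ((h + q)^-1 * (1 + (2 * q)^-1 * (2 * h))); first exact: dln.
  rewrite mulN1r oppr_lt0; apply: mulr_gt0; first by rewrite invr_gt0 addr_gt0.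
  by apply: addr_gt0 => //; apply: mulr_gt0; rewrite ?invr_gt0; apply: mulr_gt0.
- move=> x t x0 t0 xt; have [A0 qt] := lnE x t x0 t0 xt.
  rewrite -[X in _ < X](expRK r) ltr_ln ?posrE ?expR_gt0 // -hsE.
  set q := Num.sqrt _ in A0 qt *; have q0 : 0 <= q by exact: sqrtr_ge0.
  rewrite -qt ltr_pXn2r ?nnegrE ?(ltW s0) //.
  have [qs|qs] := ltP q s; apply/idP.
    have xh : x <= h by nra.
    by lra.
  have xh : h <= x by nra.
  by lra.
- move=> x t x0 t0 xt; have [A0 qt] := lnE x t x0 t0 xt.
  set q := Num.sqrt _ in A0 qt *; have q0 : 0 <= q by exact: sqrtr_ge0.
  apply/eqP/eqP => [xr|ts].
    have : x + q = h + s by rewrite hsE -xr lnK ?posrE.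
    rewrite -qt => xq; have [qs|sq|->//] := ltgtP q s.
      have xh : x <= h by nra.
      by exfalso; lra.
    have xh : h <= x by nra.
    by exfalso; lra.
  have qs : q = s by apply/eqP; rewrite -(eqrXn2 (n := 2)) ?(ltW s0) //; apply/eqP; lra.
  have xh : x = h by apply/eqP; rewrite -(eqrXn2 (n := 2)) ?ltW //; apply/eqP; lra.
  by rewrite xh qs hsE expRK.
Qed.

(** * The spectral index *)

Section SpectralIndex.
Context {R : realType} {n k : nat} (M : geometry) (P : {vspace 'rV[R]_n.+1}) (r h s2 : R).
Hypothesis k_gt0 : (0 < k)%N.
Hypothesis dimP : \dim P = k.+1.
Hypothesis poleP : pole R n \in P.
Hypothesis bdata : boundary_data M r h s2.

Local Notation kap := (curvature R M).
Local Notation phi := (graph_param M).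
Local Notation q := (Num.sqrt s2).

Section Frame.
Context (Q : 'M[R]_(k, n.+1)) (fQ : orthonormal_frame P Q).

Lemma frame_Q0 i : Q i 0 = 0. Proof. by have [_ H _] := fQ. Qed.
Lemma frame_QQ : Q *m Q^T = 1%:M. Proof. by have [_ _ H] := fQ. Qed.

Lemma graph_param_in_P y : phi Q y \in P.
Proof.
have [QP _ _] := fQ.
by rewrite memvD ?memvZ // mulmx_sum_row memv_suml // => i _; rewrite memvZ.
Qed.

Lemma graph_param_space_form y : 0 < height kap y -> space_form M (phi Q y).
Proof.
move=> h0; split; last by rewrite graph_param0 //; exact: frame_Q0.
rewrite graph_paramE (form_frame M Q frame_Q0 frame_QQ) -expr2 height_sqr //.
by rewrite mulrBr mulr1 mulrA -expr2 curvature2 mul1r subrK.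
Qed.

Lemma dist_graph_param_lt y : 0 < height kap y ->
  (dist_pole M (phi Q y) < r) = (dot y y < s2).
Proof.
move=> h0; have [_ _ _ _ [_ H _]] := bdata.
rewrite dist_poleE (graph_param0 M Q frame_Q0).
by apply: H => //; [exact: dot_ge0|exact: height_sqr].
Qed.

Lemma dist_graph_param_eq y : 0 < height kap y ->
  (dist_pole M (phi Q y) == r) = (dot y y == s2).
Proof.
move=> h0; have [_ _ _ _ [_ _ H]] := bdata.
rewrite dist_poleE (graph_param0 M Q frame_Q0).
by apply: H => //; [exact: dot_ge0|exact: height_sqr].
Qed.

Lemma ks2_gt0 : 0 < 1 - kap * s2.
Proof. by have [h0 _ <- _ _] := bdata; rewrite exprn_gt0. Qed.

Lemma height_ball (y : 'rV[R]_k) : dot y y <= s2 -> 0 < height kap y.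
Proof. exact: (height_gt0_ball kap s2 (curvature2 M) ks2_gt0). Qed.

Lemma height_boundary (y : 'rV[R]_k) : dot y y = s2 -> height kap y = h.
Proof.
have [h0 _ hE _ _] := bdata.
by move=> ys; rewrite /height ys -hE sqrtr_sqr ger0_norm // ltW.
Qed.

Lemma geodesic_ball_graph_param y : dot y y <= s2 -> geodesic_ball M P r (phi Q y).
Proof.
move=> ys; have h0 := height_ball y ys; split; [exact: graph_param_space_form| |exact: graph_param_in_P].
move: ys; rewrite !le_eqVlt -(dist_graph_param_eq y h0) -(dist_graph_param_lt y h0).
by [].
Qed.

Lemma geodesic_ball_chart p : geodesic_ball M P r p ->
  exists2 y, dot y y <= s2 & p = phi Q y.
Proof.
move=> [[pp p0] pr pP]; have E := orthonormal_frame_complete P poleP k Q p dimP fQ pP.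
set y := p *m Q^T in E.
have p00 : p 0 0 ^+ 2 = 1 - kap * dot y y.
  have := form_frame M Q frame_Q0 frame_QQ (p 0 0) (p 0 0) y y; rewrite -E pp => H.
  have := curvature2 M (R := R); move: H; set c := curvature R M => H c2.
  have -> : dot y y = c - c * (p 0 0 * p 0 0) by lra.
  have -> : c * (c - c * (p 0 0 * p 0 0)) = c ^+ 2 * (1 - p 0 0 * p 0 0) by ring.
  by rewrite c2; ring.
have hp : height kap y = p 0 0 by rewrite /height -p00 sqrtr_sqr ger0_norm // ltW.
have h0 : 0 < height kap y by rewrite hp.
have pE : p = phi Q y by rewrite graph_paramE hp.
exists y => //.
move: pr; rewrite pE !le_eqVlt (dist_graph_param_eq y h0) (dist_graph_param_lt y h0).
by [].
Qed.

Lemma conormal_boundary y : dot y y = s2 ->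
  conormal (induced_metric M Q) (fun x => dist_pole M (phi Q x)) y = (h / q) *: y.
Proof.
move=> ys; have [h0 s20 _ _ [[d dd kd] _ _]] := bdata.
have hy := height_boundary y ys.
have hy0 : 0 < height kap y by rewrite hy.
have y0 : 0 < dot y y by rewrite ys.
have FE (x : 'rV[R]_k) : dist_pole M (phi Q x) = dist_profile M (height kap x).
  by rewrite dist_poleE (graph_param0 M Q frame_Q0).
rewrite -hy in dd.
by rewrite (conormal_chartE M Q frame_Q0 frame_QQ _ d y hy0 y0 FE dd kd) hy ys.
Qed.

Lemma laplacian_C2_data f Df Hf y : C2_data s2 f Df Hf -> dot y y < s2 ->
  laplacian (induced_metric M Q) f y =
  - (\tr (Hf y) - kap * dot (y *m Hf y) y - kap * k%:R * dot (Df y) y).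
Proof.
move=> d ys; have [_ _ _ dd] := d y (ltW ys).
apply: (laplacian_chartE M Q frame_Q0 frame_QQ _ _ _ _ (height_ball y (ltW ys)) _ dd).
near=> z; have zs : dot z z < s2 by near: z; exact: near_interior.
have [_ dz _ _] := d z (ltW zs); apply/rowP => i; rewrite mxE -dot_delta.
by have [_] := dz (delta_mx 0 i).
Unshelve. all: by end_near. Qed.

End Frame.

(** The eigenvalue is pinned down only for [c != 0], since the zero function satisfies the equations
    for every [sigma]. *)
Lemma steklov_solution_proportional sigma u :
  steklov_solution M P k r (kap * k%:R) sigma u -> sigma < h / q ->
  exists c, (forall p, geodesic_ball M P r p -> u p = c * p 0 0) /\
    (c != 0 -> sigma = - kap * q / h).
Proof.
move=> [[U [_ subU su]] sol] lt_sigma.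
have [h0 s20 hE _ _] := bdata; have q0 : 0 < q by rewrite sqrtr_gt0.
have [Q fQ] := orthonormal_frame_exists P poleP k dimP.
have [int bd] := sol Q fQ.
pose f y := u (phi Q y).
have [|Df [Hf d]] := C2_data_graph_param M Q s2 U u su.
  by move=> y ys; split; [exact: height_ball|apply: subU; exact: geodesic_ball_graph_param].
have eqf : chart_equation kap s2 f.
  exists Df, Hf; split=> // y ys; have hy := height_ball y (ltW ys).
  have := int y; rewrite (laplacian_C2_data Q fQ f Df Hf y d ys) => L.
  have H : ball_interior M P r (phi Q y).
    split; [exact: graph_param_space_form| |exact: graph_param_in_P].
    by rewrite dist_graph_param_lt.
  by have := L H; rewrite /f /=; lra.
pose m := sigma * q / h.
have rf : radial_condition s2 m f.
  move=> y ys; have hy := height_boundary y ys.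
  have ys' : dot y y <= s2 by rewrite ys.
  have [_ df _ _] := d y ys'.
  have H : ball_boundary M P r (phi Q y).
    split; [by apply: graph_param_space_form => //; rewrite hy| |exact: graph_param_in_P].
    by apply/eqP; rewrite dist_graph_param_eq ?hy // ys.
  have := bd y H; rewrite (conormal_boundary Q fQ) //.
  have [_ ->] := df ((h / q) *: y); rewrite dotZr => E.
  have [dfy Dfy] := df y; split; rewrite ?Dfy //.
  have -> : dot (Df y) y = q / h * (h / q * dot (Df y) y) by field; rewrite !gt_eqF.
  by rewrite E /m /f; ring.
have m1 : m < 1 by rewrite /m -mulrA -ltr_pdivlMr ?divr_gt0 // mul1r invf_div.
have [c fc] := equation_radial_solution kap s2 s20 (curvature2 M) ks2_gt0 m f k_gt0 m1 eqf rf.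
exists c; split.
  move=> p /(geodesic_ball_chart Q fQ)[y ys ->].
  by rewrite -/(f y) fc // (graph_param0 M Q (frame_Q0 Q fQ)).
move=> c0.
pose b : 'rV[R]_k := q *: delta_mx 0 (Ordinal k_gt0).
have bs : dot b b = s2.
  by rewrite /b dotZl dotZr dot_delta mxE !eqxx mulr1 -expr2 sqr_sqrtr // ltW.
have hb := height_boundary b bs.
have fb : f b = c * h by rewrite fc ?bs // hb.
have hb0 : 0 < height kap b by rewrite hb.
(* [f] and [c * height] are known to agree only on the closed ball, so their radial derivatives at
   [b] are compared from inside; the signs [a = 1] and [a = -1] together give equality. *)
pose w (a : R) y := a * (f y + - c * height kap y).
have dw a : is_derive b b (w a) (a * (m * f b + - c * (- kap * dot b b / height kap b))).
  exact: (is_deriveZ_fun _ a _ _ _ (is_deriveD_fun _ _ _ _ _ _ (rf b bs)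
    (is_deriveZ_fun _ (- c) _ _ _ (is_derive_height kap b b hb0)))).
have w0 a (t : R) : -1 < t -> t <= 0 -> w a (b + t *: b) = 0.
  move=> t1 t0; rewrite /w fc; first by ring.
  have -> : b + t *: b = (1 + t) *: b by rewrite scalerDl scale1r.
  have tt : (1 + t) * (1 + t) <= 1 by nra.
  by rewrite dotZl dotZr bs mulrA ler_piMl // ltW.
have ge0 a : 0 <= a * (m * f b + - c * (- kap * dot b b / height kap b)).
  apply: (is_derive1_le_left (fun t => w a (b + t *: b)) 0 1) => //.
    by apply/is_derive_line0; exact: dw.
  by move=> t; rewrite sub0r => t1 t0; rewrite !w0 // ltW.
have := ge0 1; have := ge0 (-1); rewrite fb hb bs mul1r mulN1r oppr_ge0 => le ge.
have {le ge} : c * (m * h + kap * s2 / h) = 0 by lra.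
move/eqP; rewrite mulf_eq0 (negPf c0) /= => /eqP E.
have -> : sigma = m * h / q by rewrite /m; field; rewrite !gt_eqF.
have -> : m * h = - (kap * q ^+ 2 / h) by rewrite sqr_sqrtr ?ltW //; lra.
by field; rewrite !gt_eqF.
Qed.

(** The gap is [1 / (q h)], because [h^2 + kap q^2 = 1]. *)
Lemma sigma0_lt_threshold : - kap * q / h < h / q.
Proof.
have [h0 s20 hE _ _] := bdata; have q0 : 0 < q by rewrite sqrtr_gt0.
rewrite -subr_gt0; have -> : h / q - - kap * q / h = (h ^+ 2 + kap * q ^+ 2) / (q * h).
  by field; rewrite !gt_eqF.
by rewrite sqr_sqrtr ?ltW // hE subrK div1r invr_gt0 mulr_gt0.
Qed.

Lemma smooth_on_coord0 (U : set 'rV[R]_n.+1) : smooth_on U (fun x => x 0 0 : R).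
Proof.
move=> s y _; suff : (exists c, foldr (@partial R n.+1 R) (fun x => x 0 0) s = fun=> c) \/
    foldr (@partial R n.+1 R) (fun x => x 0 0) s = (fun x => x 0 0).
  by move=> [[c ->]|->] //; exact: differentiable_coord.
elim: s => [|i s IH] /=; first by right.
left; case: IH => [[c ->]|->].
  by exists 0; apply/funext => z; exact: derive_cst.
exists ((delta_mx 0 i : 'rV[R]_n.+1) 0 0); apply/funext => z.
have -> : (fun x : 'rV[R]_n.+1 => x 0 0) = (fun x => dot x (pole R n)).
  by apply/funext => x; rewrite dot_pole.
by rewrite /partial -dot_pole; have [_] := is_derive_dot z (delta_mx 0 i) (pole R n).
Qed.

Lemma steklov_solution_coord0 :
  steklov_solution M P k r (kap * k%:R) (- kap * q / h) (fun x => x 0 0).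
Proof.
have [h0 s20 hE _ _] := bdata; have q0 : 0 < q by rewrite sqrtr_gt0.
split; first by exists setT; split=> //; [exact: openT|exact: smooth_on_coord0].
move=> Q fQ phi' g eta.
have phiE : (fun z => phi' z 0 0) = height kap.
  by apply/funext => z; exact: (graph_param0 M Q (frame_Q0 Q fQ)).
have pos y : space_form M (phi' y) -> 0 < height kap y.
  by move=> [_]; rewrite (graph_param0 M Q (frame_Q0 Q fQ)).
have [Df [Hf [d E]]] := @chart_equation_height R k kap s2 (curvature2 M) ks2_gt0.
rewrite phiE; split=> y [sy dy _]; have hy := pos y sy.
  have ys : dot y y < s2 by rewrite -(dist_graph_param_lt Q fQ).
  rewrite (laplacian_C2_data Q fQ _ Df Hf y d ys) (graph_param0 M Q (frame_Q0 Q fQ)).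
  by have := E y ys; lra.
have ys : dot y y = s2 by apply/eqP; rewrite -(dist_graph_param_eq Q fQ) // dy.
rewrite /eta (conormal_boundary Q fQ) // (graph_param0 M Q (frame_Q0 Q fQ)).
have [_ ->] := is_derive_height kap y ((h / q) *: y) hy.
rewrite dotZr ys (height_boundary y ys).
have -> : h / q * s2 = h / q * q ^+ 2 by rewrite sqr_sqrtr // ltW.
by field; rewrite !gt_eqF.
Qed.

Lemma pole_in_geodesic_ball : geodesic_ball M P r (pole R n).
Proof.
have [_ s20 _ _ _] := bdata.
have [Q fQ] := orthonormal_frame_exists P poleP k dimP.
have -> : pole R n = phi Q 0.
  rewrite graph_paramE mul0mx addr0 /height dot0l mulr0 subr0 sqrtr1 scale1r //.
by apply: geodesic_ball_graph_param => //; rewrite dot0l ltW.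
Qed.

Lemma multiplicity_coord0 : multiplicity M P k r (kap * k%:R) (- kap * q / h) = 1%E.
Proof.
apply/eqP; rewrite eq_le; apply/andP; split; last first.
  apply: ereal_sup_ubound; exists 1%N => //=.
  exists (fun _ x => x 0 0); split; first by move=> _; exact: steklov_solution_coord0.
  move=> c /(_ _ pole_in_geodesic_ball); rewrite big_ord1 mxE !eqxx mulr1 => c0 i.
  by rewrite (ord1 i).
apply: ge_ereal_sup => _ [m [us [sol free]] <-].
rewrite lee_fin lern1 leqNgt; apply/negP => m1.
pose i0 := Ordinal (ltnW m1); pose i1 := Ordinal m1.
have i10 : (i1 == i0) = false by [].
have prop i := steklov_solution_proportional _ (us i) (sol i) sigma0_lt_threshold.
have [c0 [u0 _]] := prop i0; have [c1 [u1 _]] := prop i1.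
have split2 (a b : R) (F : 'I_m -> R) :
    \sum_i (if i == i0 then a else if i == i1 then b else 0) * F i = a * F i0 + b * F i1.
  rewrite (bigD1 i0) //= (bigD1 i1) ?i10 //= ?eqxx ?i10 ?eqxx big1 ?addr0 // => i.
  by move=> /andP[/negPf -> /negPf ->]; rewrite mul0r.
(* The relation [c1 u0 - c0 u1 = 0] on the ball and freeness give [c1 = 0]; then [u1] vanishes on
   the ball, which contradicts freeness again. *)
have c10 : c1 = 0.
  have := free (fun i => if i == i0 then c1 else if i == i1 then - c0 else 0).
  move=> /(_ _ i0); rewrite eqxx; apply => p pb.
  by rewrite split2 u0 // u1 //; ring.
have /eqP : (1 : R) = 0; last by rewrite oner_eq0.
have := free (fun i => if i == i0 then 0 else if i == i1 then 1 else 0).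
move=> /(_ _ i1); rewrite i10 eqxx; apply => p pb.
by rewrite split2 u1 // c10; ring.
Qed.

Theorem spectral_index_eq1 : spectral_index M P k r = 1%E.
Proof.
have [_ _ _ thr _] := bdata.
rewrite /spectral_index thr.
have -> : [set sigma | steklov_eigenvalue M P k r (kap * k%:R) sigma /\
    sigma < h / q] = [set - kap * q / h].
  apply/seteqP; split=> sigma /=.
    move=> [[u [su [p pb up]]]] lt_sigma.
    have [c [uc]] := steklov_solution_proportional sigma u su lt_sigma; apply.
    by apply: contra_neq up => c0; rewrite uc // c0 mul0r.
  move=> ->; split; last exact: sigma0_lt_threshold.
  exists (fun x => x 0 0); split; first exact: steklov_solution_coord0.
  exists (pole R n); first exact: pole_in_geodesic_ball.
  by rewrite mxE !eqxx oner_neq0.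
by rewrite esum_set1 multiplicity_coord0.
Qed.

End SpectralIndex.

Theorem proposition5p6 (R : realType) (n k : nat) (r : R)
  (P : {vspace 'rV[R]_n.+1})
  (hk : (1 <= k)%N) (hkn : (k < n)%N)
  (hdim : \dim P = k.+1) (hpole : pole R n \in P) :
  (0 < r < pi / 2 -> spectral_index Spherical P k r = 1%E) /\
  (0 < r -> spectral_index Hyperbolic P k r = 1%E).
Proof.
split=> hr.
- exact: (spectral_index_eq1 _ _ _ _ _ hk hdim hpole (spherical_boundary_data r hr)).
- exact: (spectral_index_eq1 _ _ _ _ _ hk hdim hpole (hyperbolic_boundary_data r hr)).
Qed.
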